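(* Let $d \geq 1$ and $\widetilde Z \sim \widetilde Z(2n, n^{-\alpha})$. If $\alpha < 1/d$, then with overwhelming probability $H_{2d}(\widetilde Z; \mathbb{Q}) = 0$. If $\alpha < 1/(d+1)$, then with overwhelming probability $H_{2d-1}(\widetilde Z; \mathbb{Q}) = 0$.
   Context: For a finite simple graph $G$, $\widetilde Z(G)$ is the simplicial complex on $V(G)\times\{-1,+1\}$ whose faces are $(\sigma\times\{-1\})\cup(\tau\times\{+1\})$ for (possibly empty) cliques $\sigma,\tau$ of $G$ that are disjoint with no edge of $G$ between them (the separated deleted join of the clique complex of $G$). $\widetilde Z(2n,p)$ is the distribution of $\widetilde Z(G)$ for $G\sim G(n,p)$, the Erdős–Rényi random graph on $[n]$. Here $\alpha>0$. ''With overwhelming probability'' means with probability at least $1-n^{-\omega(1)}$ as $n\to\infty$. *)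

(* Defs.v *)
From HB Require Import structures.
From mathcomp Require Import all_boot all_order all_algebra.
From mathcomp Require Import boolp reals exp.
Set Implicit Arguments. Unset Strict Implicit. Unset Printing Implicit Defensive.
Import Order.TTheory GRing.Theory Num.Theory.
Local Open Scope ring_scope.

Section Homology.
Variable V : finType.

Definition is_simplicial_complex (K : {set {set V}}) : bool :=
  [forall s in K, forall t : {set V}, (t \subset s) ==> (t \in K)].

(* Vertices are oriented by the fixed total order enum_rank on V.  The
   incidence coefficient [sigma : tau] of the boundary map from
   k-chains (faces with k+1 vertices) to (k-1)-chains; the boundary of a
   0-chain is 0 (unreduced homology). *)
Definition incid (K : {set {set V}}) (k : nat) (s t : {set V}) : rat :=
  if [&& s \in K, #|s| == k.+1 & (0 < k)%N] then
    \sum_(v in s) (if t == s :\ v then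
                     (-1) ^+ #|[set u in s | (enum_rank u < enum_rank v)%N]|
                   else 0)
  else 0.

Definition boundary (K : {set {set V}}) (k : nat) (c : {ffun {set V} -> rat})
  : {ffun {set V} -> rat} :=
  [ffun t => \sum_(s : {set V}) c s * incid K k s t].

Definition is_kchain (K : {set {set V}}) (k : nat) (c : {ffun {set V} -> rat}) :=
  forall s, c s != 0 -> (s \in K) && (#|s| == k.+1).

Definition homology_vanishes (K : {set {set V}}) (k : nat) : Prop :=
  forall c, is_kchain K k c -> boundary K k c = 0 ->
    exists e, is_kchain K k.+1 e /\ boundary K k.+1 e = c.
End Homology.

Definition all_pairs (n : nat) : {set {set 'I_n}} := [set e : {set 'I_n} | #|e| == 2].
Definition is_graph n (E : {set {set 'I_n}}) : bool := E \subset all_pairs n.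

Definition adj n (E : {set {set 'I_n}}) (i j : 'I_n) : bool :=
  (i != j) && ([set i; j] \in E).

Definition is_clique n (E : {set {set 'I_n}}) (s : {set 'I_n}) : bool :=
  [forall i in s, forall j in s, (i != j) ==> adj E i j].

(* vertex (i, false) stands for (i,-1) and (i, true) for (i,+1) *)
Definition Zt n (E : {set {set 'I_n}}) : {set {set ('I_n * bool)}} :=
  [set F : {set ('I_n * bool)} |
    let s := [set i | (i, false) \in F] in
    let t := [set i | (i, true) \in F] in
    [&& is_clique E s, is_clique E t, [disjoint s & t] &
        [forall i in s, forall j in t, ~~ adj E i j]]].

Definition ER_weight (R : realType) n (p : R) (E : {set {set 'I_n}}) : R :=
  p ^+ #|E| * (1 - p) ^+ ('C(n, 2) - #|E|).

Definition ER_prob (R : realType) n (p : R) (P : {set {set 'I_n}} -> Prop) : R :=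
  \sum_(E : {set {set 'I_n}} | is_graph E && `[< P E >]) ER_weight p E.

(* "with overwhelming probability" for G ~ G(n, n^-alpha):
   failure probability is n^{-omega(1)}, i.e. <= n^{-C} eventually, for all C *)
Definition whp_overwhelming (R : realType) (alpha : R)
  (P : forall n, {set {set 'I_n}} -> Prop) : Prop :=
  forall C : R, 0 < C -> exists N : nat, forall n : nat, (N <= n)%N ->
    ER_prob (n%:R `^ (- alpha)) (fun E => ~ P n E) <= n%:R `^ (- C).

(* Main.v *)
Require Import Defs.
From HB Require Import structures.
From mathcomp Require Import all_boot all_order all_algebra.
From mathcomp Require Import boolp reals exp.
From mathcomp Require Import zify ring lra.
Import Order.TTheory GRing.Theory Num.Theory.
Local Open Scope ring_scope.
Set Implicit Arguments. Unset Strict Implicit. Unset Printing Implicit Defensive.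

(** Garland's method.  By a local-to-global identity, [H_k] of a complex vanishes
    as soon as, in the link graph of every [(k-1)]-face, the adjacency form is
    at most [lam < 1/(k+1)] times the degree form on functions orthogonal to
    constants.

    The complex is flag, and the link graph of a face [(sigma, tau)] with
    [|sigma| <= |tau|] consists of the common neighbours [A] of [sigma] missing
    [tau] and the common neighbours [B] of [tau] missing [sigma], joined by [G]
    inside [A] and inside [B] and by the complement of [G] across.  Up to small
    errors its adjacency form is [p (sum_A f)^2 + 2 (sum_A f) (sum_B f)], and
    orthogonality to constants makes this nonpositive.  The errors are controlled
    by two properties of [G]: sets of at most [d] vertices have about
    [n p^|sigma|] common neighbours and larger sets have far fewer, and for
    [|sigma| < d] the centred adjacency matrix of [G] on the common neighbours of
    [sigma] has small spectral norm.

    Both hold with overwhelming probability because [n p^d] is a positive power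
    of [n]: a fixed high moment (of a centred degree, resp. the trace of a high
    power of the centred matrix) only receives contributions from products in
    which every edge is repeated, and Markov's inequality at a sufficiently high
    moment beats every power of [n]. *)

(** * Garland's criterion *)

Section WeightedProjection.
Variable F : realFieldType.

Lemma weighted_gram_eq0 m n (w : 'rV[F]_m) (Z : 'M[F]_(m, n)) :
  (forall i, 0 < w 0 i) -> Z^T *m diag_mx w *m Z = 0 -> Z = 0.
Proof.
move=> w_gt0 gram0; apply/matrixP => i j; rewrite [RHS]mxE.
have : \sum_l w 0 l * Z l j ^+ 2 = 0.
  transitivity ((Z^T *m diag_mx w *m Z) j j); last by rewrite gram0 mxE.
  by rewrite mul_mx_diag mxE; apply: eq_bigr => l _; rewrite !mxE; ring.
move/eqP; rewrite psumr_eq0 => [|l _]; last by rewrite mulr_ge0 ?sqr_ge0 ?ltW.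
move/allP/(_ i (mem_index_enum _)).
by rewrite /= mulf_eq0 expf_eq0 (gt_eqF (w_gt0 i)) => /eqP.
Qed.

Lemma weighted_mx_residue m n (P : 'M[F]_(m, n)) (w c : 'rV[F]_n) :
  (forall j, 0 < w 0 j) -> exists y : 'rV_m, (c - y *m P) *m diag_mx w *m P^T = 0.
Proof.
move=> w_gt0; set gram := P *m diag_mx w *m P^T.
have ker0 : P^T *m cokermx gram = 0.
  apply: (weighted_gram_eq0 w_gt0).
  transitivity ((cokermx gram)^T *m (gram *m cokermx gram)).
    by rewrite trmx_mul trmxK !mulmxA.
  by rewrite mulmx_coker mulmx0.
have /submxP[y yE] : (c *m diag_mx w *m P^T <= gram)%MS.
  by rewrite submxE -!mulmxA ker0 !mulmx0.
by exists y; rewrite !mulmxBl yE /gram !mulmxA subrr.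
Qed.

Lemma weighted_residue (I J : finType) (P : I -> J -> F) (w c : J -> F) :
  (forall j, 0 < w j) ->
  exists y : I -> F, forall i, \sum_j (c j - \sum_i' y i' * P i' j) * w j * P i j = 0.
Proof.
move=> w_gt0.
pose PM : 'M[F]_(#|I|, #|J|) := \matrix_(i, j) P (enum_val i) (enum_val j).
pose row (f : J -> F) : 'rV[F]_#|J| := \row_j f (enum_val j).
have [j|y yE] := @weighted_mx_residue _ _ PM (row w) (row c); first by rewrite mxE.
exists (fun i => y 0 (enum_rank i)) => i.
have /rowP/(_ (enum_rank i)) := yE; rewrite mul_mx_diag !mxE => residue0; rewrite -[RHS]residue0.
rewrite (reindex (@enum_val J predT)) /=; last exact/onW_bij/enum_val_bij.
apply: eq_bigr => j _; rewrite !mxE enum_rankK; congr ((_ - _) * _ * _).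
rewrite (reindex (@enum_val I predT)) /=; last exact/onW_bij/enum_val_bij.
by apply: eq_bigr => l _; rewrite !mxE enum_valK.
Qed.
End WeightedProjection.

Section Links.
Variable V : finType.
Implicit Types (K : {set {set V}}) (s t : {set V}) (u v : V).

Definition faces K k : {set {set V}} := [set s in K | #|s| == k].

Definition link K t : {set V} := [set u | (u \notin t) && (u |: t \in K)].

Definition vertex_sign v s : rat := (-1) ^+ #|[set u in s | (enum_rank u < enum_rank v)%N]|.

Lemma setD1C s u v : s :\ u :\ v = s :\ v :\ u.
Proof. by rewrite !setDDl setUC. Qed.

Lemma facesP K k s : reflect (s \in K /\ #|s| = k) (s \in faces K k).
Proof. by rewrite inE; apply: (iffP andP) => -[? /eqP]. Qed.

Lemma complex_subset_closed K s t :
  is_simplicial_complex K -> s \in K -> t \subset s -> t \in K.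
Proof. by move=> /forall_inP closedK /closedK/forallP/(_ t)/implyP; apply. Qed.

Lemma facesD1 K k s v :
  is_simplicial_complex K -> s \in faces K k.+1 -> v \in s -> s :\ v \in faces K k.
Proof.
move=> complexK /facesP[sK cs] vs; apply/facesP; split.
  by rewrite (complex_subset_closed complexK sK) ?subD1set.
by move: cs; rewrite (cardsD1 v) vs => -[].
Qed.

Lemma facesU1 K k t u : t \in faces K k -> u \in link K t -> u |: t \in faces K k.+1.
Proof.
by case/facesP => _ <-; rewrite inE => /andP[ut utK]; apply/facesP; rewrite cardsU1 ut.
Qed.

Lemma sum_faces_link (M : nmodType) K k (g : {set V} -> V -> M) :
  is_simplicial_complex K ->
  \sum_(s in faces K k.+1) \sum_(u in s) g (s :\ u) u =
  \sum_(t in faces K k) \sum_(u in link K t) g t u.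
Proof.
move=> complexK; rewrite (exchange_big_dep predT) //= [RHS](exchange_big_dep predT) //=.
apply: eq_bigr => u _.
rewrite (reindex_onto (fun t => u |: t) (fun s => s :\ u)) /=; last first.
  by move=> s /andP[_ us]; rewrite setD1K.
apply: eq_big => [t|t /andP[_ /eqP-> //]].
rewrite setU11 andbT; apply/andP/andP => [[utF /eqP utD]|[tF ul]].
  have ut : u \notin t by rewrite -utD !inE eqxx.
  rewrite -{1}utD (facesD1 complexK utF) ?setU11 // inE ut.
  by case/facesP: utF.
by rewrite (facesU1 tF ul) setU1K //; move: ul; rewrite inE => /andP[].
Qed.

Lemma vertex_sign_sqr v s : vertex_sign v s ^+ 2 = 1.
Proof. exact: sqrr_sign. Qed.

Lemma vertex_sign_setU1 v s : vertex_sign v (v |: s) = vertex_sign v s.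
Proof.
rewrite /vertex_sign; congr (_ ^+ #|pred_of_set _|); apply/setP => u; rewrite !inE.
by case: eqP => //= ->; rewrite ltnn andbF.
Qed.

Lemma vertex_sign_setD1 u v s : u \in s ->
  vertex_sign v s = (-1) ^+ (enum_rank u < enum_rank v)%N * vertex_sign v (s :\ u).
Proof.
move=> us; rewrite /vertex_sign (cardsD1 u [set _ in s | _]) inE us exprD; congr (_ * _ ^+ _).
by apply: eq_card => x; rewrite !inE andbA.
Qed.

Lemma vertex_sign_swap u v s : u \in s -> v \in s -> u != v ->
  vertex_sign u s * vertex_sign v (s :\ u) = - (vertex_sign v s * vertex_sign u (s :\ v)).
Proof.
move=> us vs uv; rewrite (vertex_sign_setD1 v us) (vertex_sign_setD1 u vs).
have : (enum_rank u : nat) != enum_rank v by rewrite (inj_eq val_inj) (inj_eq enum_rank_inj).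
by case: ltngtP => // _ _; ring.
Qed.

Lemma vertex_sign_mul u v s : u \in s -> v \in s -> u != v ->
  vertex_sign u (s :\ v :\ u) * vertex_sign v (s :\ v :\ u) =
  - (vertex_sign u s * vertex_sign v s).
Proof.
move=> us vs uv; have uD : u \in s :\ v by rewrite !inE uv.
have -> : vertex_sign u (s :\ v :\ u) = vertex_sign u (s :\ v).
  by rewrite -(vertex_sign_setU1 u (s :\ v :\ u)) setD1K.
have -> : vertex_sign v (s :\ v :\ u) = vertex_sign v (s :\ u).
  by rewrite setD1C -(vertex_sign_setU1 v (s :\ u :\ v)) setD1K // !inE eq_sym uv.
transitivity (vertex_sign u s * (vertex_sign u s * vertex_sign v (s :\ u)) *
              vertex_sign u (s :\ v)).
  by rewrite mulrA -expr2 vertex_sign_sqr mul1r mulrC.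
rewrite vertex_sign_swap // mulrN mulNr; congr (- _).
by rewrite !mulrA -[_ * _ * _ * _]mulrA -expr2 vertex_sign_sqr mulr1.
Qed.
End Links.

Section Boundary.
Variables (V : finType) (K : {set {set V}}).
Implicit Types (s t : {set V}) (c e : {ffun {set V} -> rat}).

Lemma kchain_eq0 k c s : is_kchain K k c -> s \notin faces K k.+1 -> c s = 0.
Proof. by move=> kc; rewrite inE => sF; apply/eqP; apply: contraNT sF => /kc. Qed.

Lemma incidE k s t : (0 < k)%N -> s \in faces K k.+1 ->
  incid K k s t = \sum_(v in s) if t == s :\ v then vertex_sign v s else 0.
Proof. by move=> k_gt0 /facesP[sK cs]; rewrite /incid sK cs eqxx k_gt0. Qed.

Lemma sum_incid k s (g : {set V} -> rat) : (0 < k)%N -> s \in faces K k.+1 ->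
  \sum_t g t * incid K k s t = \sum_(v in s) g (s :\ v) * vertex_sign v s.
Proof.
move=> k_gt0 sF; under eq_bigr => t _ do rewrite incidE // mulr_sumr.
rewrite exchange_big; apply: eq_bigr => v vs.
by rewrite (bigD1 (s :\ v)) //= eqxx big1 ?addr0 // => t /negPf ->; rewrite mulr0.
Qed.

Lemma boundaryE k c t : (0 < k)%N -> is_kchain K k c ->
  boundary K k c t = \sum_(u | u \notin t) c (u |: t) * vertex_sign u (u |: t).
Proof.
move=> k_gt0 kc; rewrite ffunE.
transitivity (\sum_(s : {set V}) \sum_(u in s) if t == s :\ u then c s * vertex_sign u s else 0).
  apply: eq_bigr => s _; have [sF|/(kchain_eq0 kc) ->] := boolP (s \in faces K k.+1).
    by rewrite incidE // mulr_sumr; apply: eq_bigr => u _; case: ifP; rewrite ?mulr0.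
  by rewrite mul0r big1 // => u _; rewrite mul0r if_same.
rewrite (exchange_big_dep predT) //= [RHS]big_mkcond; apply: eq_bigr => u _.
case: ifPn => [ut|/negbNE ut].
  rewrite (bigD1 (u |: t)) ?setU11 //= setU1K // eqxx big1 ?addr0 // => s /andP[us].
  by case: (t =P s :\ u) => // ->; rewrite setD1K // eqxx.
by apply: big1 => s us; case: eqP ut => // ->; rewrite !inE eqxx.
Qed.

Hypothesis complexK : is_simplicial_complex K.

Lemma boundary_kchain k c : (0 < k)%N -> is_kchain K k (boundary K k.+1 c).
Proof.
move=> k_gt0 t; rewrite ffunE; apply: contraR => tF.
rewrite big1 // => s _; have [sF|sF] := boolP (s \in faces K k.+2).
  rewrite incidE // big1 ?mulr0 // => v vs; case: eqP => // tE; case/negP: tF.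
  by rewrite tE; have := facesD1 complexK sF vs; rewrite inE.
rewrite /incid; case: ifP; rewrite ?mulr0 // => /and3P[sK cs _].
by rewrite inE sK cs in sF.
Qed.

Lemma boundary_boundary k e : (0 < k)%N -> is_kchain K k.+1 e ->
  boundary K k (boundary K k.+1 e) = 0.
Proof.
move=> k_gt0 ke; apply/ffunP => t; rewrite boundaryE //; last exact: boundary_kchain.
rewrite [RHS]ffunE.
pose a u v := e (v |: (u |: t)) * vertex_sign v (v |: (u |: t)) * vertex_sign u (u |: t).
have aC u v : u != v -> u \notin t -> v \notin t -> a v u = - a u v.
  move=> uv ut vt; rewrite /a setUCA -!mulrA -mulrN; congr (_ * _).
  set s := v |: (u |: t).
  have sDv : s :\ v = u |: t by rewrite setU1K // !inE negb_or vt eq_sym uv.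
  have sDu : s :\ u = v |: t by rewrite /s setUCA setU1K // !inE negb_or ut uv.
  by rewrite -sDv -sDu vertex_sign_swap // !inE eqxx ?orbT.
pose S := \sum_(u | u \notin t) \sum_(v | (v \notin t) && (v != u)) a u v.
have -> : \sum_(u | u \notin t) boundary K k.+1 e (u |: t) * vertex_sign u (u |: t) = S.
  apply: eq_bigr => u ut; rewrite boundaryE // mulr_suml.
  by apply: eq_bigl => v; rewrite !inE negb_or andbC.
have : S = - S.
  rewrite {1}/S (exchange_big_dep (fun v => v \notin t)) /=; last by move=> u v _ /andP[].
  rewrite -sumrN; apply: eq_bigr => v vt; rewrite -sumrN.
  apply: eq_big => [u|u /andP[ut]]; first by rewrite vt /= eq_sym.
  by rewrite vt /= => uv; rewrite aC // eq_sym.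
by move/eqP; rewrite -addr_eq0 -mulr2n mulrn_eq0 /= => /eqP.
Qed.
End Boundary.

Section Garland.
Variables (V : finType) (K : {set {set V}}).
Hypothesis complexK : is_simplicial_complex K.
Implicit Types (s t : {set V}) (u v : V) (c e : {ffun {set V} -> rat}) (phi : {set V} -> rat).

(* The neighbours of [u] in the link graph of [t] form [link K (u |: t)]. *)
Definition link_form (R : pzRingType) t (f : V -> R) : R :=
  \sum_(u in link K t) \sum_(v in link K (u |: t)) f u * f v.

Definition link_degree_sum (R : pzRingType) t (f : V -> R) : R :=
  \sum_(u in link K t) #|link K (u |: t)|%:R * f u.

Definition localize phi t u : rat := vertex_sign u t * phi (u |: t).

Definition cocycle k phi :=
  forall s, s \in faces K k.+2 -> \sum_(v in s) phi (s :\ v) * vertex_sign v s = 0.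

Definition energy k phi : rat := \sum_(s in faces K k.+1) #|link K s|%:R * phi s ^+ 2.

Lemma energyE k phi :
  energy k phi = \sum_(s in faces K k.+2) \sum_(u in s) (phi (s :\ u) * vertex_sign u s) ^+ 2.
Proof.
under [RHS]eq_bigr => s _ do under eq_bigr => u _ do rewrite exprMn vertex_sign_sqr mulr1.
rewrite (sum_faces_link _ (fun t _ => phi t ^+ 2) complexK); apply: eq_bigr => s _.
by rewrite sumr_const mulr_natl.
Qed.

Lemma sum_link_form k (f : {set V} -> V -> rat) :
  \sum_(t in faces K k) link_form t (f t) =
  \sum_(s in faces K k.+2) \sum_(v in s) \sum_(u in s :\ v) f (s :\ v :\ u) u * f (s :\ v :\ u) v.
Proof.
transitivity (\sum_(t in faces K k) \sum_(u in link K t) \sum_(v in link K (u |: t))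
    f ((u |: t) :\ u) u * f ((u |: t) :\ u) v).
  apply: eq_bigr => t _; apply: eq_bigr => u; rewrite inE => /andP[ut _].
  by rewrite setU1K.
rewrite -(sum_faces_link k (fun t u => \sum_(v in link K (u |: t))
  f ((u |: t) :\ u) u * f ((u |: t) :\ u) v) complexK).
rewrite (sum_faces_link k.+1 (fun s v => \sum_(u in s) f (s :\ u) u * f (s :\ u) v) complexK).
apply: eq_bigr => s _; rewrite [RHS]exchange_big; apply: eq_bigr => u us /=.
by rewrite setD1K.
Qed.

Lemma localize_mul phi s u v : u \in s -> v \in s -> u != v ->
  localize phi (s :\ v :\ u) u * localize phi (s :\ v :\ u) v =
  - ((phi (s :\ u) * vertex_sign u s) * (phi (s :\ v) * vertex_sign v s)).
Proof.
move=> us vs uv; rewrite /localize setD1K; last by rewrite !inE uv.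
have -> : v |: s :\ v :\ u = s :\ u.
  by rewrite setD1C setD1K // !inE eq_sym uv.
rewrite mulrACA vertex_sign_mul // mulNr; congr (- _); ring.
Qed.

(* The square of the coboundary, which vanishes, has the energy as its diagonal
   part and the local forms as its off-diagonal part. *)
Lemma garland_identity k phi : cocycle k phi ->
  energy k phi = \sum_(t in faces K k) link_form t (localize phi t).
Proof.
move=> phi_cocycle; rewrite energyE sum_link_form; apply: eq_bigr => s sF.
apply/eqP; rewrite -subr_eq0 -sumrB; apply/eqP.
have := congr1 (fun x => x ^+ 2) (phi_cocycle s sF).
rewrite expr0n expr2 mulr_suml => coboundary_sqr; rewrite -[RHS]coboundary_sqr.
apply: eq_bigr => v vs; rewrite mulr_sumr [RHS](bigD1 v) //= expr2; congr (_ + _).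
rewrite -sumrN; apply: eq_big => [u|u]; first by rewrite !inE andbC.
by rewrite !inE => /andP[uv us]; rewrite localize_mul // opprK mulrC.
Qed.

Lemma sum_link_degree_sum k phi :
  \sum_(t in faces K k) link_degree_sum t (fun u => localize phi t u ^+ 2) =
  k.+1%:R * energy k phi.
Proof.
rewrite /link_degree_sum.
under eq_bigr => t _ do under eq_bigr => u _ do rewrite exprMn vertex_sign_sqr mul1r.
rewrite -(sum_faces_link k (fun t u => #|link K (u |: t)|%:R * phi (u |: t) ^+ 2) complexK).
rewrite mulr_sumr; apply: eq_bigr => s /facesP[_ <-].
rewrite mulr_natl -sumr_const; apply: eq_bigr => u us.
by rewrite setD1K.
Qed.

Lemma link_degree_sum_localize k c phi t : (0 < k)%N -> is_kchain K k c ->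
  boundary K k c = 0 -> (forall s, s \in faces K k.+1 -> #|link K s|%:R * phi s = c s) ->
  t \in faces K k -> link_degree_sum t (localize phi t) = 0.
Proof.
move=> k_gt0 kc /ffunP/(_ t) + phiE tF.
rewrite boundaryE // [RHS]ffunE => c_cycle; rewrite -[RHS]c_cycle.
rewrite [RHS](bigID (mem (link K t))) /= [X in _ + X]big1 ?addr0 => [|u /andP[ut ul]].
  apply: eq_big => [u|u ul]; first by rewrite inE; case: (u \in t).
  by rewrite mulrCA phiE ?(facesU1 tF) // vertex_sign_setU1 mulrC.
rewrite (kchain_eq0 kc) ?mul0r //; apply: contraNN ul => /facesP[utK _].
by rewrite inE ut.
Qed.

(* [e] is obtained by projecting [c] orthogonally onto the boundaries. *)
Lemma weighted_cocycle_representative k c (w : {set V} -> rat) :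
  (forall s, 0 < w s) ->
  exists2 e, is_kchain K k.+1 e & cocycle k (fun s => (c - boundary K k.+1 e) s / w s).
Proof.
move=> w_gt0; have winv_gt0 s : 0 < (w s)^-1 by rewrite invr_gt0.
have [y yE] := weighted_residue (incid K k.+1) c winv_gt0.
pose e : {ffun {set V} -> rat} := [ffun s => if s \in faces K k.+2 then y s else 0].
exists e => [s|s sF]; first by rewrite ffunE inE; case: ifP; rewrite ?eqxx.
rewrite -(sum_incid (fun t => (c - boundary K k.+1 e) t / w t) _ sF) // -[RHS](yE s).
apply: eq_bigr => t _; rewrite !ffunE; congr ((_ - _) / _ * _).
apply: eq_bigr => r _; rewrite ffunE inE /incid.
by case: (r \in K); case: (#|r| == _); rewrite /= ?mulr0 ?mul0r.
Qed.

Lemma energy_ge0 k phi : 0 <= energy k phi.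
Proof. by apply: sumr_ge0 => s _; rewrite mulr_ge0 ?sqr_ge0. Qed.

Lemma energy_eq0 k phi s :
  energy k phi = 0 -> s \in faces K k.+1 -> (0 < #|link K s|)%N -> phi s = 0.
Proof.
move=> /eqP + sF deg_gt0; rewrite psumr_eq0 => [|t _]; last by rewrite mulr_ge0 ?sqr_ge0.
move=> /allP/(_ s (mem_index_enum _)); rewrite sF mulf_eq0 expf_eq0 pnatr_eq0 /=.
by rewrite -[_ == 0]negbK -lt0n deg_gt0 => /eqP.
Qed.

Section LocalToGlobal.
Variables (R : realFieldType) (k : nat) (lam : R).
Hypothesis lam_lt : k.+1%:R * lam < 1.
Hypothesis link_form_le : forall t (f : V -> R), t \in faces K k -> link_degree_sum t f = 0 ->
  link_form t f <= lam * link_degree_sum t (fun u => f u ^+ 2).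

Lemma link_form_ratr t (f : V -> rat) : link_form t (ratr \o f) = ratr (link_form t f) :> R.
Proof.
rewrite rmorph_sum; apply: eq_bigr => u _; rewrite rmorph_sum; apply: eq_bigr => v _.
by rewrite rmorphM.
Qed.

Lemma link_degree_sum_ratr t (f : V -> rat) :
  link_degree_sum t (ratr \o f) = ratr (link_degree_sum t f) :> R.
Proof.
by rewrite rmorph_sum; apply: eq_bigr => u _; rewrite rmorphM /= ratr_nat.
Qed.

Lemma cocycle_energy_eq0 phi : cocycle k phi ->
  (forall t, t \in faces K k -> link_degree_sum t (localize phi t) = 0) -> energy k phi = 0.
Proof.
move=> phi_cocycle phi_orth.
have energy_le : ratr (energy k phi) <= lam * (k.+1%:R * ratr (energy k phi)).
  rewrite -[k.+1%:R](ratr_nat R) -rmorphM -sum_link_degree_sum {1}garland_identity //.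
  rewrite rmorph_sum [X in _ <= _ * X]rmorph_sum mulr_sumr /=.
  apply: ler_sum => t tF; rewrite -link_form_ratr -link_degree_sum_ratr.
  apply: le_trans (link_form_le tF _) _; first by rewrite link_degree_sum_ratr phi_orth ?rmorph0.
  rewrite le_eqVlt; apply/predU1l; congr (_ * _).
  by apply: eq_bigr => u _ /=; rewrite rmorphXn.
apply/eqP; rewrite eq_le energy_ge0 andbT -(ler_rat R) rmorph0 leNgt.
apply: contraTN energy_le => energy_gt0.
by rewrite mulrCA mulrA -ltNge -[ltRHS]mul1r ltr_pM2r.
Qed.

Theorem garland : (0 < k)%N ->
  (forall s, s \in faces K k.+1 -> (0 < #|link K s|)%N) -> homology_vanishes K k.
Proof.
move=> k_gt0 deg_gt0 c kc c_cycle.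
pose w s : rat := if s \in faces K k.+1 then #|link K s|%:R else 1.
have w_gt0 s : 0 < w s by rewrite /w; case: ifP => // /deg_gt0; rewrite ltr0n.
have [e ke e_cocycle] := weighted_cocycle_representative k c w_gt0.
exists e; split=> //; set c' := c - boundary K k.+1 e in e_cocycle.
have kc' : is_kchain K k c'.
  move=> s; have -> : c' s = c s - boundary K k.+1 e s by rewrite !ffunE.
  have [|sF] := boolP (s \in faces K k.+1); first by rewrite inE.
  rewrite (kchain_eq0 kc) // (kchain_eq0 _ sF) ?subrr ?eqxx //.
  exact: boundary_kchain.
have c'_cycle : boundary K k c' = 0.
  have : boundary K k c - boundary K k (boundary K k.+1 e) = 0.
    by rewrite c_cycle boundary_boundary // subrr.
  move=> <-; apply/ffunP => t; rewrite !ffunE -sumrB; apply: eq_bigr => s _.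
  by rewrite !ffunE mulrBl.
have phiE s : s \in faces K k.+1 -> #|link K s|%:R * (c' s / w s) = c' s.
  by move=> sF; have := w_gt0 s; rewrite /w sF => ?; rewrite mulrC divfK // gt_eqF.
have phi_energy := cocycle_energy_eq0 e_cocycle
  (fun t => link_degree_sum_localize k_gt0 kc' c'_cycle phiE).
apply/esym/eqP; rewrite -subr_eq0 -/c'; apply/eqP/ffunP => s; rewrite [RHS]ffunE.
have [sF|/(kchain_eq0 kc') //] := boolP (s \in faces K k.+1).
by rewrite -phiE // (energy_eq0 phi_energy sF) ?mulr0 ?deg_gt0.
Qed.
End LocalToGlobal.
End Garland.

(** * The adjacency form of a link *)

Lemma cauchy_schwarz_sum (R : realDomainType) (I : finType) (P : pred I) (f g : I -> R) :
  (\sum_(i | P i) f i * g i) ^+ 2 <= (\sum_(i | P i) f i ^+ 2) * (\sum_(i | P i) g i ^+ 2).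
Proof.
have : 0 <= \sum_(i | P i) \sum_(j | P j) (f i * g j - f j * g i) ^+ 2.
  by apply: sumr_ge0 => i _; apply: sumr_ge0 => j _; apply: sqr_ge0.
have -> : \sum_(i | P i) \sum_(j | P j) (f i * g j - f j * g i) ^+ 2 =
   2 * ((\sum_(i | P i) f i ^+ 2) * (\sum_(i | P i) g i ^+ 2)
        - (\sum_(i | P i) f i * g i) ^+ 2).
  transitivity (\sum_(i | P i) \sum_(j | P j)
      (f i ^+ 2 * g j ^+ 2 + g i ^+ 2 * f j ^+ 2 - 2 * ((f i * g i) * (f j * g j)))).
    by apply: eq_bigr => i _; apply: eq_bigr => j _; ring.
  under eq_bigr => i _ do rewrite sumrB big_split /= -!mulr_sumr.
  rewrite sumrB big_split /= -!mulr_suml -mulr_sumr -mulr_suml; ring.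
by rewrite pmulr_rge0 // subr_ge0.
Qed.

Lemma sqr_sum_le (R : realDomainType) (I : finType) (A : {set I}) (f : I -> R) :
  (\sum_(u in A) f u) ^+ 2 <= #|A|%:R * \sum_(u in A) f u ^+ 2.
Proof.
have := cauchy_schwarz_sum (mem A) (fun=> 1) f.
by under eq_bigr do rewrite mul1r; rewrite expr1n sumr_const.
Qed.

Lemma sqr_sum_mul_le (R : realDomainType) (I : finType) (A : {set I}) (f g : I -> R) c :
  (forall u, u \in A -> `|f u| <= c) ->
  (\sum_(u in A) f u * g u) ^+ 2 <= #|A|%:R * (c ^+ 2 * \sum_(u in A) g u ^+ 2).
Proof.
move=> f_le; apply: le_trans (sqr_sum_le _ _) _; rewrite ler_wpM2l // mulr_sumr.
apply: ler_sum => u uA; rewrite exprMn ler_wpM2r ?sqr_ge0 // -real_normK ?num_real //.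
by rewrite lerXn2r ?nnegrE ?f_le // (le_trans _ (f_le u uA)).
Qed.

Section EdgeForms.
Variables (R : realFieldType) (T : finType) (e : rel T).
Implicit Types (A B C : {set T}) (f g h : T -> R).

Definition degree_in A u : R := #|[set v in A | e u v]|%:R.

Definition edge_form A B g h : R := \sum_(u in A) \sum_(v in B) (e u v)%:R * g u * h v.

Lemma degree_inE A u : degree_in A u = \sum_(v in A) (e u v)%:R.
Proof.
rewrite /degree_in -sum1_card natr_sum big_mkcond [RHS]big_mkcond /=.
by apply: eq_bigr => v _; rewrite inE; case: (v \in A); case: (e u v).
Qed.

Lemma degree_in_ge0 A u : 0 <= degree_in A u.
Proof. exact: ler0n. Qed.

Lemma sum_degree_in_le A B g c : (forall u, u \in A -> degree_in B u <= c) ->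
  \sum_(u in A) degree_in B u * g u ^+ 2 <= c * \sum_(u in A) g u ^+ 2.
Proof.
by move=> deg_le; rewrite mulr_sumr; apply: ler_sum => u /deg_le ?; rewrite ler_wpM2r ?sqr_ge0.
Qed.

Definition centred_form p A g : R := edge_form A A g g - p * (\sum_(u in A) g u) ^+ 2.

Lemma centred_formE p A g :
  centred_form p A g = \sum_(u in A) \sum_(v in A) ((e u v)%:R - p) * g u * g v.
Proof.
rewrite /centred_form expr2 mulr_suml mulr_sumr -sumrB; apply: eq_bigr => u _.
rewrite mulrA mulr_sumr -sumrB; apply: eq_bigr => v _; ring.
Qed.

Lemma centred_form_le_subset p (c : R) A C : A \subset C ->
  (forall f, `|centred_form p C f| <= c * \sum_(u in C) f u ^+ 2) ->
  forall g, `|centred_form p A g| <= c * \sum_(u in A) g u ^+ 2.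
Proof.
move=> /subsetP AC form_le g; pose f u := if u \in A then g u else 0.
have sum_f (F : T -> R -> R) : (forall u, F u 0 = 0) ->
    \sum_(u in C) F u (f u) = \sum_(u in A) F u (g u).
  move=> F0; rewrite big_mkcond [RHS]big_mkcond; apply: eq_bigr => u _; rewrite /f.
  by case: (boolP (u \in A)) => [/AC -> //|_]; rewrite F0 if_same.
have := form_le f; rewrite !centred_formE (sum_f (fun _ x => x ^+ 2)) ?expr0n //.
rewrite (sum_f (fun u x => \sum_(v in C) ((e u v)%:R - p) * x * f v)); last first.
  by move=> u; rewrite big1 // => v _; rewrite mulr0 mul0r.
under eq_bigr => u _.
  rewrite (sum_f (fun v y => ((e u v)%:R - p) * g u * y)); last by move=> v; rewrite mulr0.
  over.
by [].
Qed.

Hypothesis e_sym : symmetric e.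

Lemma edge_form_le A B g h :
  2 * `|edge_form A B g h| <=
  \sum_(u in A) degree_in B u * g u ^+ 2 + \sum_(v in B) degree_in A v * h v ^+ 2.
Proof.
have -> : \sum_(u in A) degree_in B u * g u ^+ 2 =
    \sum_(u in A) \sum_(v in B) (e u v)%:R * g u ^+ 2.
  by apply: eq_bigr => u _; rewrite degree_inE mulr_suml.
have -> : \sum_(v in B) degree_in A v * h v ^+ 2 =
    \sum_(u in A) \sum_(v in B) (e u v)%:R * h v ^+ 2.
  rewrite exchange_big; apply: eq_bigr => v _; rewrite degree_inE mulr_suml.
  by apply: eq_bigr => u _; rewrite e_sym.
rewrite -big_split /=.
apply: le_trans (ler_wpM2l _ (ler_norm_sum _ _ _)) _ => //.
rewrite mulr_sumr; apply: ler_sum => u _.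
rewrite -big_split /=; apply: le_trans (ler_wpM2l _ (ler_norm_sum _ _ _)) _ => //.
rewrite mulr_sumr; apply: ler_sum => v _; rewrite -mulrA normrM normrM normr_nat mulrCA -mulrDr.
rewrite ler_wpM2l // -(real_normK (num_real (g u))) -(real_normK (num_real (h v))).
by have := sqr_ge0 (`|g u| - `|h v|); rewrite sqrrB; lra.
Qed.

Lemma edge_form_diag_le A g : `|edge_form A A g g| <= \sum_(u in A) degree_in A u * g u ^+ 2.
Proof. by have := edge_form_le A A g g; lra. Qed.

Lemma centred_form_le_degree p A g : 0 <= p ->
  `|centred_form p A g| <=
  \sum_(u in A) degree_in A u * g u ^+ 2 + p * #|A|%:R * \sum_(u in A) g u ^+ 2.
Proof.
move=> p_ge0; apply: le_trans (ler_normB _ _) _; apply: lerD; first exact: edge_form_diag_le.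
by rewrite (ger0_norm (mulr_ge0 p_ge0 (sqr_ge0 _))) -mulrA ler_wpM2l ?sqr_sum_le.
Qed.

(* The graph on [A] and [B] with the edges of [e] inside [A] and inside [B], and the
    non-edges of [e] across. *)
Definition twisted_degree A B u : R := degree_in A u + (#|B|%:R - degree_in B u).

Definition twisted_form A B g h : R :=
  edge_form A A g g + edge_form B B h h +
  2 * ((\sum_(u in A) g u) * (\sum_(v in B) h v) - edge_form A B g h).

(* The twisted degrees to expect when edges have density [p] and [B] is at most about as
   large as [A]: [p |A| + |B|] on [A], and [|A|] up to a negligible error on [B]. *)
Definition expected_degree p A B : R := p * #|A|%:R + #|B|%:R.

Definition quasirandom_pair p eps A B : Prop :=
  [/\ forall u, u \in A -> `|degree_in A u - p * #|A|%:R| <= eps * expected_degree p A B,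
      forall u, u \in A -> degree_in B u <= eps * expected_degree p A B,
      forall v, v \in B -> degree_in B v <= eps * #|A|%:R,
      forall v, v \in B -> degree_in A v <= eps * #|A|%:R &
      forall g, `|centred_form p A g| <= eps * expected_degree p A B * \sum_(u in A) g u ^+ 2].

Section QuasirandomPair.
Variables (A B : {set T}) (p eps : R).
Local Notation a := (#|A|%:R : R).
Local Notation b := (#|B|%:R : R).
Local Notation D := (expected_degree p A B).
Hypotheses (p_gt0 : 0 < p) (eps_gt0 : 0 < eps) (eps_le : eps <= 8^-1) (A_neq0 : A != set0).
Hypothesis AB_quasirandom : quasirandom_pair p eps A B.

Let p_ge0 : 0 <= p. Proof. exact: ltW. Qed.
Let a_gt0 : 0 < a. Proof. by rewrite ltr0n card_gt0. Qed.
Let D_gt0 : 0 < D. Proof. by rewrite ltr_wpDr // mulr_gt0. Qed.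

Lemma twisted_degree_left_near u : u \in A -> `|D - twisted_degree A B u| <= 2 * eps * D.
Proof.
case: AB_quasirandom => degAA degAB _ _ _ uA.
have := degAA u uA; have := degAB u uA; have := degree_in_ge0 B u.
by rewrite !ler_norml /twisted_degree /expected_degree => ? ? /andP[? ?]; apply/andP; split; lra.
Qed.

Lemma twisted_degree_right_near v : v \in B -> `|a - twisted_degree B A v| <= eps * a.
Proof.
case: AB_quasirandom => _ _ degBB degBA _ vB.
have := degBB v vB; have := degBA v vB; have := degree_in_ge0 A v; have := degree_in_ge0 B v.
by rewrite ler_norml /twisted_degree => ? ? ? ?; apply/andP; split; lra.
Qed.

Lemma twisted_degree_left_ge u : u \in A -> 3 / 4 * D <= twisted_degree A B u.
Proof.
move=> /twisted_degree_left_near; rewrite ler_norml => /andP[_ near].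
have : eps * D <= 8^-1 * D by rewrite ler_wpM2r // ltW.
lra.
Qed.

Lemma twisted_degree_right_ge v : v \in B -> 3 / 4 * a <= twisted_degree B A v.
Proof.
move=> /twisted_degree_right_near; rewrite ler_norml => /andP[_ near].
have : eps * a <= 8^-1 * a by rewrite ler_wpM2r.
by move: a_gt0; lra.
Qed.

Lemma twisted_degree_left_gt0 u : u \in A -> 0 < twisted_degree A B u.
Proof. by move=> /twisted_degree_left_ge; apply: lt_le_trans; rewrite mulr_gt0 // divr_gt0. Qed.

Lemma twisted_degree_right_gt0 v : v \in B -> 0 < twisted_degree B A v.
Proof. by move=> /twisted_degree_right_ge; apply: lt_le_trans; rewrite mulr_gt0 // divr_gt0. Qed.

Section Form.
Variables (g h : T -> R).
Let G := \sum_(u in A) g u.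
Let H := \sum_(v in B) h v.
Let normg := \sum_(u in A) g u ^+ 2.
Let normh := \sum_(v in B) h v ^+ 2.
Let degree_sum f k :=
  \sum_(u in A) twisted_degree A B u * f u + \sum_(v in B) twisted_degree B A v * k v.

Let normg_ge0 : 0 <= normg. Proof. by apply: sumr_ge0 => *; apply: sqr_ge0. Qed.
Let normh_ge0 : 0 <= normh. Proof. by apply: sumr_ge0 => *; apply: sqr_ge0. Qed.

Lemma sqr_expected_degree_sum_le : degree_sum g h = 0 ->
  (D * G + a * H) ^+ 2 <= a * D * (eps * (D * normg + a * normh)).
Proof.
move=> orth.
pose errA := \sum_(u in A) (D - twisted_degree A B u) * g u.
pose errB := \sum_(v in B) (a - twisted_degree B A v) * h v.
have -> : D * G + a * H = errA + errB.
  have -> : errA = D * G - \sum_(u in A) twisted_degree A B u * g u.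
    by rewrite mulr_sumr -sumrB; apply: eq_bigr => u _; rewrite mulrBl.
  have -> : errB = a * H - \sum_(v in B) twisted_degree B A v * h v.
    by rewrite mulr_sumr -sumrB; apply: eq_bigr => u _; rewrite mulrBl.
  by move: orth; rewrite /degree_sum; lra.
have errA_le : errA ^+ 2 <= a * ((2 * eps * D) ^+ 2 * normg).
  exact: sqr_sum_mul_le twisted_degree_left_near.
have errB_le : errB ^+ 2 <= D * ((eps * a) ^+ 2 * normh).
  apply: le_trans (sqr_sum_mul_le _ twisted_degree_right_near) _.
  rewrite ler_wpM2r //; first by rewrite mulr_ge0 ?sqr_ge0.
  by rewrite /expected_degree lerDr mulr_ge0.
have sqrD_le : (errA + errB) ^+ 2 <= 2 * errA ^+ 2 + 2 * errB ^+ 2.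
  by have := sqr_ge0 (errA - errB); rewrite sqrrB sqrrD; lra.
have [eps_ge0 D_ge0] : 0 <= eps /\ 0 <= D by rewrite !ltW.
have eps_sqr_le x : 0 <= x -> eps * (eps * x) <= 8^-1 * (eps * x).
  by move=> x_ge0; rewrite ler_wpM2r // mulr_ge0.
have g_ge0 : 0 <= a * D * (D * normg) by rewrite !mulr_ge0.
have h_ge0 : 0 <= a * D * (a * normh) by rewrite !mulr_ge0.
have := eps_sqr_le _ g_ge0; have := eps_sqr_le _ h_ge0; have := mulr_ge0 eps_ge0 h_ge0.
have -> : a * D * (eps * (D * normg + a * normh)) =
  eps * (a * D * (D * normg)) + eps * (a * D * (a * normh)) by ring.
move: sqrD_le errA_le errB_le; lra.
Qed.

(* [a D (p G^2 + 2 G H)] is [(D G + a H)^2] minus two nonnegative terms, and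
   orthogonality makes [D G + a H] small. *)
Lemma mean_form_le : degree_sum g h = 0 ->
  p * G ^+ 2 + 2 * (G * H) <= eps * (D * normg + a * normh).
Proof.
move=> orth; rewrite -(@ler_pM2l _ (a * D)) ?mulr_gt0 //.
apply: le_trans _ (sqr_expected_degree_sum_le orth); rewrite -subr_ge0.
have -> : (D * G + a * H) ^+ 2 - a * D * (p * G ^+ 2 + 2 * (G * H)) =
  D * b * G ^+ 2 + (a * H) ^+ 2 by rewrite /expected_degree; ring.
by rewrite addr_ge0 ?sqr_ge0 // mulr_ge0 ?sqr_ge0 // mulr_ge0 // ltW.
Qed.

Lemma degree_norm_le : 3 / 4 * (D * normg + a * normh) <=
  degree_sum (fun u => g u ^+ 2) (fun v => h v ^+ 2).
Proof.
rewrite mulrDr !mulrA !mulr_sumr.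
apply: lerD; apply: ler_sum => u uS; rewrite ler_wpM2r ?sqr_ge0 //.
  exact: twisted_degree_left_ge.
exact: twisted_degree_right_ge.
Qed.

Lemma twisted_form_le : degree_sum g h = 0 ->
  twisted_form A B g h <= 4 * eps * degree_sum (fun u => g u ^+ 2) (fun v => h v ^+ 2).
Proof.
case: AB_quasirandom => _ degAB degBB degBA formAA /mean_form_le mean_le.
have := ler_wpM2l (ltW eps_gt0) degree_norm_le.
have := formAA g; have := edge_form_diag_le B h; have := edge_form_le A B g h.
have := sum_degree_in_le h degBB; have := sum_degree_in_le h degBA.
have := sum_degree_in_le g degAB; rewrite -/normg -/normh -/G.
move: mean_le; rewrite /twisted_form -/G -/H.
have := ler_norm (- edge_form A B g h); have := ler_norm (edge_form B B h h).
have := ler_norm (centred_form p A g); rewrite normrN /centred_form -/G.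
move: (p * G ^+ 2) (G * H) => ? ?; lra.
Qed.
End Form.
End QuasirandomPair.
End EdgeForms.

(** * Links in the separated deleted join *)

Section Neighbourhoods.
Variables (n : nat) (E : {set {set 'I_n}}).
Implicit Types (i j w z : 'I_n) (s t : {set 'I_n}).

Definition common_nbrs s : {set 'I_n} := [set w | [forall z in s, adj E w z]].

Definition separated_nbrs s t : {set 'I_n} :=
  [set w in common_nbrs s | [forall z in t, (w != z) && ~~ adj E w z]].

Lemma adj_sym : symmetric (adj E).
Proof. by move=> i j; rewrite /adj eq_sym setUC. Qed.

Lemma adjxx i : adj E i i = false.
Proof. by rewrite /adj eqxx. Qed.

Lemma is_cliqueP s : reflect {in s &, forall i j, i != j -> adj E i j} (is_clique E s).
Proof.
apply: (iffP forall_inP) => [clique i j si sj ij|clique i si].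
  by have /forall_inP/(_ j sj)/implyP := clique i si; apply.
by apply/forall_inP => j sj; apply/implyP; apply: clique.
Qed.

Lemma common_nbrsP s w : reflect (forall z, z \in s -> adj E w z) (w \in common_nbrs s).
Proof. by rewrite inE; apply: forall_inP. Qed.

Lemma separated_nbrsP s t w :
  reflect ((forall z, z \in s -> adj E w z) /\ (forall z, z \in t -> w != z /\ ~~ adj E w z))
          (w \in separated_nbrs s t).
Proof.
rewrite inE; apply: (iffP andP) => -[].
  by move=> /common_nbrsP nbr /forall_inP sep; split=> // z /sep/andP.
by move=> nbr sep; split; [apply/common_nbrsP|apply/forall_inP => z /sep/andP].
Qed.

Lemma common_nbrs0 : common_nbrs set0 = setT.
Proof. by apply/setP => w; rewrite in_setT; apply/common_nbrsP => z; rewrite inE. Qed.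

Lemma mem_common_nbrsU1 v s w :
  (w \in common_nbrs (v |: s)) = (w \in common_nbrs s) && adj E w v.
Proof.
apply/common_nbrsP/andP => [nbr|[/common_nbrsP nbr wv] z].
  by split; [apply/common_nbrsP => z zs|]; apply: nbr; rewrite !inE ?zs ?eqxx ?orbT.
by rewrite !inE => /predU1P[->|/nbr].
Qed.

Lemma common_nbrs_notin s w : w \in common_nbrs s -> w \notin s.
Proof. by move/common_nbrsP => nbr; apply/negP => /nbr; rewrite adjxx. Qed.

Lemma common_nbrsS s t : s \subset t -> common_nbrs t \subset common_nbrs s.
Proof.
by move/subsetP => st; apply/subsetP => w /common_nbrsP nbr; apply/common_nbrsP => z /st/nbr.
Qed.

Lemma separated_nbrs_sub s t : separated_nbrs s t \subset common_nbrs s.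
Proof. by apply/subsetP => w; rewrite inE => /andP[]. Qed.

Lemma separated_nbrs_notin_l s t w : w \in separated_nbrs s t -> w \notin s.
Proof. by move/(subsetP (separated_nbrs_sub s t)); apply: common_nbrs_notin. Qed.

Lemma separated_nbrs_notin_r s t w : w \in separated_nbrs s t -> w \notin t.
Proof. by case/separated_nbrsP => _ sep; apply/negP => /sep[]; rewrite eqxx. Qed.

Lemma separated_nbrsU1 u s t :
  separated_nbrs (u |: s) t = [set v in separated_nbrs s t | adj E u v].
Proof.
apply/setP => v; rewrite [LHS]inE mem_common_nbrsU1 [RHS]inE andbAC (adj_sym u); congr (_ && _).
by rewrite [RHS]inE.
Qed.

Lemma separated_nbrs_disjoint s t w : s :|: t != set0 ->
  w \in separated_nbrs s t -> w \notin separated_nbrs t s.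
Proof.
case/set0Pn => z zst /separated_nbrsP[adj_s sep_t].
apply/negP => /separated_nbrsP[adj_t sep_s]; move: zst; rewrite inE => /orP[zs|zt].
  by have [_] := sep_s z zs; rewrite adj_s.
by have [_] := sep_t z zt; rewrite adj_t.
Qed.

Lemma card_common_nbrs_le s t : (#|common_nbrs s| <=
  #|separated_nbrs s t| + \sum_(z in t) #|common_nbrs (z |: s)|.+1)%N.
Proof.
have cover : common_nbrs s \subset
    separated_nbrs s t :|: \bigcup_(z in t) (z |: common_nbrs (z |: s)).
  apply/subsetP => w ws; rewrite in_setU -implyNb; apply/implyP.
  rewrite inE ws negb_forall_in => /exists_inP[z zt]; rewrite negb_and !negbK => wz.
  apply/bigcupP; exists z; rewrite // !in_setU1 mem_common_nbrsU1 ws.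
  by case/orP: wz => [/eqP ->|->]; rewrite ?eqxx ?orbT.
apply: leq_trans (subset_leq_card cover) _; apply: leq_trans (leq_card_setU _ _) _.
rewrite leq_add2l.
apply: (big_ind2 (fun (X : {set 'I_n}) m => (#|X| <= m)%N)) => [|X k Y m Xk Ym|z _].
- by rewrite cards0.
- exact: leq_trans (leq_card_setU _ _) (leq_add Xk Ym).
- by rewrite cardsU1 -add1n leq_add2r leq_b1.
Qed.

Lemma degree_in_le (R : realFieldType) (C s : {set 'I_n}) u : C \subset common_nbrs s ->
  degree_in R (adj E) C u <= #|common_nbrs (u |: s)|%:R.
Proof.
move/subsetP => Cs; rewrite ler_nat subset_leq_card //.
by apply/subsetP => v; rewrite inE mem_common_nbrsU1 adj_sym => /andP[/Cs -> ->].
Qed.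
End Neighbourhoods.

Section SeparatedJoin.
Variables (n : nat) (E : {set {set 'I_n}}).
Implicit Types (x y : 'I_n * bool) (F : {set 'I_n * bool}) (i j : 'I_n) (b c : bool).

Definition compatible x y : bool :=
  if x.2 == y.2 then adj E x.1 y.1 else (x.1 != y.1) && ~~ adj E x.1 y.1.

Definition side b F : {set 'I_n} := [set i | (i, b) \in F].

Definition link_side F b : {set 'I_n} := separated_nbrs E (side b F) (side (~~ b) F).

Lemma compatible_sym : symmetric compatible.
Proof. by move=> x y; rewrite /compatible eq_sym adj_sym (eq_sym x.1). Qed.

Lemma compatiblexx x : compatible x x = false.
Proof. by rewrite /compatible eqxx adjxx. Qed.

Lemma compatible_same i j b : compatible (i, b) (j, b) = adj E i j.
Proof. by rewrite /compatible eqxx. Qed.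

Lemma compatible_opp i j b : compatible (i, b) (j, ~~ b) = (i != j) && ~~ adj E i j.
Proof. by rewrite /compatible /=; case: b. Qed.

Lemma ZtP F : reflect {in F &, forall x y, x != y -> compatible x y} (F \in Zt E).
Proof.
rewrite inE; apply: (iffP and4P) => [[/is_cliqueP neg /is_cliqueP pos disj /forall_inP sep]|compat].
  have opp i j : (i, false) \in F -> (j, true) \in F -> compatible (i, false) (j, true).
    move=> iF jF; rewrite /compatible /=.
    have := sep i; rewrite inE => /(_ iF)/forall_inP/(_ j); rewrite inE => /(_ jF) ->.
    rewrite andbT.
    by apply: contraTneq iF => ->; have /pred0P/(_ j) := disj; rewrite /= !inE jF andbT => ->.
  case=> i [] [j []] iF jF; rewrite xpair_eqE ?andbT => ij.
  - by rewrite compatible_same pos ?inE.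
  - by rewrite compatible_sym opp.
  - exact: opp.
  - by rewrite compatible_same neg ?inE.
have clique b : is_clique E (side b F).
  apply/is_cliqueP => i j; rewrite !inE => iF jF ij.
  by rewrite -(compatible_same i j b) compat // xpair_eqE negb_and ij.
have opp i j : (i, false) \in F -> (j, true) \in F -> (i != j) && ~~ adj E i j.
  by move=> iF jF; rewrite -(compatible_opp i j false) compat // xpair_eqE andbF.
split; [exact: clique|exact: clique| |].
  by apply/pred0P => i; rewrite /= !inE; apply/negP => /andP[iF /(opp i i iF)]; rewrite eqxx.
apply/forall_inP => i; rewrite inE => iF; apply/forall_inP => j; rewrite inE => jF.
by case/andP: (opp i j iF jF).
Qed.

Lemma Zt_complex : is_simplicial_complex (Zt E).
Proof.
apply/forall_inP => F /ZtP compat; apply/forallP => G; apply/implyP => /subsetP GF.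
by apply/ZtP; apply: sub_in2 compat.
Qed.

Lemma card_side F : (#|side false F| + #|side true F| = #|F|)%N.
Proof.
have card_sideE b : #|side b F| = #|[set x in F | x.2 == b]|.
  rewrite -(card_imset _ (f := fun i => (i, b))); last by move=> i j [].
  apply: eq_card => -[i b']; rewrite !inE; apply/imsetP/andP => [[j]|[iF /eqP <-]].
    by rewrite inE => jF [-> ->].
  by exists i; rewrite ?inE.
rewrite !card_sideE -(cardsID [set x | x.2 == false] F).
by congr (_ + _)%N; apply: eq_card => -[i []]; rewrite !inE ?andbT ?andbF.
Qed.

Lemma side_disjoint F b : F \in Zt E -> [disjoint side b F & side (~~ b) F].
Proof.
move=> /ZtP compat; apply/pred0P => i; rewrite /= !inE; apply/negP => /andP[iF iF'].
have := compat _ _ iF iF'; rewrite xpair_eqE compatible_opp eqxx /=.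
by case: (b) => /(_ isT).
Qed.

Lemma mem_link_compatible F x :
  F \in Zt E -> (x \in link (Zt E) F) = [forall y in F, compatible x y].
Proof.
move=> /ZtP compat; rewrite inE; apply/andP/forall_inP => [[xF /ZtP xcompat] y yF|xcompat].
  by apply: xcompat; rewrite ?setU11 ?setU1r //; apply: contraNneq xF => ->.
split; first by apply/negP => /xcompat; rewrite compatiblexx.
apply/ZtP => y z /setU1P[->|yF] /setU1P[->|zF]; rewrite ?eqxx //.
- by move=> _; apply: xcompat.
- by move=> _; rewrite compatible_sym xcompat.
- exact: compat.
Qed.

Lemma mem_linkU1 F x y : F \in Zt E -> x \in link (Zt E) F ->
  (y \in link (Zt E) (x |: F)) = (y \in link (Zt E) F) && compatible x y.
Proof.
move=> FZ xl; have xFZ : x |: F \in Zt E by move: xl; rewrite inE => /andP[].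
rewrite !mem_link_compatible // andbC.
apply/forall_inP/andP => [ycompat|[xy /forall_inP ycompat] z].
  split; first by rewrite compatible_sym ycompat ?setU11.
  by apply/forall_inP => z zF; rewrite ycompat ?setU1r.
by case/setU1P => [->|/ycompat //]; rewrite compatible_sym.
Qed.

Lemma mem_link F i b : F \in Zt E -> ((i, b) \in link (Zt E) F) = (i \in link_side F b).
Proof.
move=> FZ; rewrite mem_link_compatible //; apply/forall_inP/separated_nbrsP.
  move=> compat; split=> z; rewrite inE => /compat; first by rewrite compatible_same.
  by rewrite compatible_opp => /andP[].
case=> nbr sep [j c] jF; have [cE|cb] := eqVneq c b.
  by rewrite cE compatible_same nbr // inE -cE.
have cE : c = ~~ b by move: cb; case: (c) (b) => -[].
by have [|ij nadj] := sep j; rewrite ?inE -?cE // cE compatible_opp ij.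
Qed.
End SeparatedJoin.

Section LinkForms.
Variables (n : nat) (E : {set {set 'I_n}}) (F : {set 'I_n * bool}).
Hypotheses (FZ : F \in Zt E) (F_neq0 : F != set0).
Implicit Types (i j : 'I_n) (b c : bool).

Lemma link_side_disjoint b i : i \in link_side E F b -> i \notin link_side E F (~~ b).
Proof.
rewrite /link_side negbK; apply: separated_nbrs_disjoint.
have [[i' b'] iF] := set0Pn _ F_neq0; apply/set0Pn; exists i'.
by rewrite !inE; case: b' b iF => -[] ->; rewrite ?orbT.
Qed.

Lemma sum_link (M : nmodType) b (g : 'I_n * bool -> M) :
  \sum_(x in link (Zt E) F) g x =
  \sum_(i in link_side E F b) g (i, b) + \sum_(i in link_side E F (~~ b)) g (i, ~~ b).
Proof.
pose h i c := if i \in link_side E F c then g (i, c) else 0.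
transitivity (\sum_i \sum_c h i c).
  rewrite pair_bigA big_mkcond; apply: eq_bigr => -[i c] _ /=.
  by rewrite mem_link.
rewrite [\sum_(i in link_side E F b) _]big_mkcond [\sum_(i in link_side E F (~~ b)) _]big_mkcond.
rewrite -big_split; apply: eq_bigr => i _; rewrite big_bool /h.
by case: b => //=; rewrite addrC.
Qed.

Section Forms.
Variable R : realFieldType.
Implicit Types (f : 'I_n * bool -> R) (g h : 'I_n -> R).

Lemma sum_linkU1 x b f : x \in link (Zt E) F ->
  \sum_(y in link (Zt E) (x |: F)) f y =
  \sum_(i in link_side E F b) (compatible E x (i, b))%:R * f (i, b) +
  \sum_(i in link_side E F (~~ b)) (compatible E x (i, ~~ b))%:R * f (i, ~~ b).
Proof.
move=> xl; rewrite -(sum_link b (fun y => (compatible E x y)%:R * f y)).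
rewrite big_mkcond [RHS]big_mkcond; apply: eq_bigr => y _.
rewrite mem_linkU1 //; case: (y \in _) => //=.
by case: compatible; rewrite ?mul1r ?mul0r.
Qed.

Lemma compatible_across b i j : i \in link_side E F b -> j \in link_side E F (~~ b) ->
  (compatible E (i, b) (j, ~~ b))%:R = 1 - (adj E i j)%:R :> R.
Proof.
move=> /link_side_disjoint ib jb; rewrite compatible_opp (contraNneq _ ib) => [|-> //].
by case: adj; rewrite ?subrr ?subr0.
Qed.

Lemma card_linkU1 i b : i \in link_side E F b ->
  #|link (Zt E) ((i, b) |: F)|%:R =
  twisted_degree R (adj E) (link_side E F b) (link_side E F (~~ b)) i.
Proof.
move=> ib; rewrite -sum1_card natr_sum (sum_linkU1 b) ?mem_link // /twisted_degree !degree_inE.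
congr (_ + _); first by apply: eq_bigr => j _; rewrite compatible_same mulr1.
rewrite -sum1_card natr_sum -sumrB; apply: eq_bigr => j jb.
by rewrite mulr1 compatible_across.
Qed.

Lemma link_degree_sum_Zt b f : link_degree_sum (Zt E) F f =
  \sum_(i in link_side E F b)
    twisted_degree R (adj E) (link_side E F b) (link_side E F (~~ b)) i * f (i, b) +
  \sum_(i in link_side E F (~~ b))
    twisted_degree R (adj E) (link_side E F (~~ b)) (link_side E F b) i * f (i, ~~ b).
Proof.
rewrite /link_degree_sum (sum_link b); congr (_ + _); apply: eq_bigr => i ib.
  by rewrite card_linkU1.
by rewrite card_linkU1 // negbK.
Qed.

Lemma sum_compatible_across b g h :
  \sum_(i in link_side E F b) \sum_(j in link_side E F (~~ b))
    (compatible E (i, b) (j, ~~ b))%:R * (g i * h j) =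
  (\sum_(i in link_side E F b) g i) * (\sum_(j in link_side E F (~~ b)) h j) -
  edge_form (adj E) (link_side E F b) (link_side E F (~~ b)) g h.
Proof.
rewrite mulr_suml -sumrB; apply: eq_bigr => i ib; rewrite mulr_sumr -sumrB.
by apply: eq_bigr => j jb; rewrite compatible_across // mulrBl mul1r mulrA.
Qed.

Lemma link_form_Zt b f : link_form (Zt E) F f =
  twisted_form (adj E) (link_side E F b) (link_side E F (~~ b))
    (fun i => f (i, b)) (fun i => f (i, ~~ b)).
Proof.
have sum_same c : \sum_(i in link_side E F c) \sum_(j in link_side E F c)
    (compatible E (i, c) (j, c))%:R * (f (i, c) * f (j, c)) =
    edge_form (adj E) (link_side E F c) (link_side E F c) (fun i => f (i, c)) (fun i => f (i, c)).
  by apply: eq_bigr => i _; apply: eq_bigr => j _; rewrite compatible_same mulrA.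
have sum_swap : \sum_(i in link_side E F (~~ b)) \sum_(j in link_side E F b)
    (compatible E (i, ~~ b) (j, b))%:R * (f (i, ~~ b) * f (j, b)) =
    \sum_(i in link_side E F b) \sum_(j in link_side E F (~~ b))
    (compatible E (i, b) (j, ~~ b))%:R * (f (i, b) * f (j, ~~ b)).
  rewrite exchange_big; apply: eq_bigr => i _; apply: eq_bigr => j _.
  by rewrite compatible_sym [f (j, _) * _]mulrC.
rewrite /link_form (sum_link b) /twisted_form.
have row_sum x : x \in link (Zt E) F -> \sum_(y in link (Zt E) (x |: F)) f x * f y =
  \sum_(i in link_side E F b) (compatible E x (i, b))%:R * (f x * f (i, b)) +
  \sum_(i in link_side E F (~~ b)) (compatible E x (i, ~~ b))%:R * (f x * f (i, ~~ b)).
  exact: (sum_linkU1 b (fun y => f x * f y)).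
under eq_bigr => i ib do rewrite row_sum ?mem_link //.
under [X in _ + X]eq_bigr => i ib do rewrite row_sum ?mem_link //.
rewrite !big_split /= !sum_same sum_swap (sum_compatible_across b (fun i => f (i, b))); ring.
Qed.
End Forms.
End LinkForms.

(** * Vanishing homology of pseudorandom graphs *)

Definition mean_nbrs (R : realFieldType) n (p : R) m : R := n%:R * p ^+ m.

Definition pseudorandom (R : realFieldType) n (E : {set {set 'I_n}}) (p delta : R) d : Prop :=
  [/\ forall s : {set 'I_n}, (#|s| <= d)%N ->
        `|#|common_nbrs E s|%:R - mean_nbrs n p #|s| | <= delta * mean_nbrs n p #|s|,
      forall s : {set 'I_n}, #|s| = d.+1 -> #|common_nbrs E s|%:R <= delta * mean_nbrs n p d &
      forall (s : {set 'I_n}) (f : 'I_n -> R), (#|s| < d)%N ->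
        `|centred_form (adj E) p (common_nbrs E s) f| <=
        delta * mean_nbrs n p #|s|.+1 * \sum_(u in common_nbrs E s) f u ^+ 2].

Section MeanNbrs.
Variables (R : realFieldType) (n : nat) (p : R).
Hypothesis p_ge0 : 0 <= p.

Lemma mean_nbrsS m : mean_nbrs n p m.+1 = p * mean_nbrs n p m.
Proof. by rewrite /mean_nbrs exprS mulrCA. Qed.

Lemma mean_nbrs_ge0 m : 0 <= mean_nbrs n p m.
Proof. by rewrite mulr_ge0 ?exprn_ge0. Qed.

Lemma mean_nbrs_le m k : p <= 1 -> (m <= k)%N -> mean_nbrs n p k <= mean_nbrs n p m.
Proof. by move=> p_le1 mk; rewrite ler_wpM2l // ler_wiXn2l. Qed.
End MeanNbrs.

Section PseudorandomLinks.
Variables (R : realFieldType) (n : nat) (E : {set {set 'I_n}}) (p delta : R) (d : nat).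
Local Notation q := (mean_nbrs n p).
Hypotheses (p_gt0 : 0 < p) (p_le_delta : p <= delta) (delta_le1 : delta <= 1).
Hypothesis delta_qd_ge1 : 1 <= delta * q d.
Hypothesis E_pseudorandom : pseudorandom E p delta d.
Implicit Types (s t r C : {set 'I_n}) (z : 'I_n).

Let p_ge0 : 0 <= p. Proof. exact: ltW. Qed.
Let p_le1 : p <= 1. Proof. exact: le_trans p_le_delta delta_le1. Qed.
Let delta_ge0 : 0 <= delta. Proof. exact: le_trans p_ge0 p_le_delta. Qed.
Let q_ge0 m : 0 <= q m. Proof. exact: mean_nbrs_ge0. Qed.
Let q_le m k : (m <= k)%N -> q k <= q m. Proof. exact: mean_nbrs_le. Qed.

Lemma delta_mul_mean_nbrs_ge1 m : (m <= d)%N -> 1 <= delta * q m.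
Proof. by move=> md; apply: le_trans delta_qd_ge1 _; rewrite ler_wpM2l ?q_le. Qed.

Lemma mean_nbrs_gt0 m : (m <= d)%N -> 0 < q m.
Proof.
move/delta_mul_mean_nbrs_ge1; rewrite lt_neqAle q_ge0 andbT.
by case: eqP => // <-; rewrite mulr0 ler10.
Qed.

Lemma common_nbrs_le s : (#|s| <= d)%N -> #|common_nbrs E s|%:R <= (1 + delta) * q #|s|.
Proof.
by case: E_pseudorandom => nbrs_near _ _ /nbrs_near; rewrite ler_norml => /andP[_]; lra.
Qed.

Lemma common_nbrs_le_large s : (d < #|s|)%N -> #|common_nbrs E s|%:R <= delta * q d.
Proof.
move=> ds; have : (0 < #|[set t : {set 'I_n} | (t \subset s) && (#|t| == d.+1)]|)%N.
  by rewrite cards_draws bin_gt0.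
rewrite card_gt0 => /set0Pn[t]; rewrite inE => /andP[ts /eqP td].
case: E_pseudorandom => _ nbrs_le _; apply: le_trans (nbrs_le t td).
by rewrite ler_nat subset_leq_card // common_nbrsS.
Qed.

Lemma common_nbrsU1_le s z : (#|s| <= d)%N -> z \notin s ->
  #|common_nbrs E (z |: s)|%:R <= 2 * delta * q #|s|.
Proof.
move=> sd zs; have cardU1 : #|z |: s| = #|s|.+1 by rewrite cardsU1 zs.
have [sd'|ds] := leqP #|s|.+1 d.
  have := @common_nbrs_le (z |: s); rewrite cardU1 mean_nbrsS => /(_ sd'); move/le_trans; apply.
  by rewrite mulrA ler_wpM2r // ler_pM ?addr_ge0 //; move: delta_le1; lra.
have sE : #|s| = d by apply/eqP; rewrite eqn_leq sd.
have := @common_nbrs_le_large (z |: s); rewrite cardU1 sE => /(_ (ltnSn _)); move/le_trans; apply.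
by rewrite ler_wpM2r // ler_peMl ?ler1n.
Qed.

Lemma separated_nbrs_le s t : (#|s| <= d)%N ->
  #|separated_nbrs E s t|%:R <= (1 + delta) * q #|s|.
Proof.
move=> sd; apply: le_trans (common_nbrs_le sd).
by rewrite ler_nat subset_leq_card // separated_nbrs_sub.
Qed.

Lemma separated_nbrs_ge s t : (#|s| <= d)%N -> [disjoint s & t] ->
  (1 - (3 * #|t|%:R + 1) * delta) * q #|s| <= #|separated_nbrs E s t|%:R.
Proof.
move=> sd st.
have card_le : #|common_nbrs E s|%:R <=
    #|separated_nbrs E s t|%:R + \sum_(z in t) (3 * delta * q #|s|) :> R.
  have := card_common_nbrs_le E s t; rewrite -(ler_nat R) natrD natr_sum => /le_trans; apply.
  rewrite lerD2l; apply: ler_sum => z zt.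
  have zs : z \notin s by apply: contraTN zt => zs; rewrite (disjointFr st zs).
  by rewrite -natr1; have := common_nbrsU1_le sd zs; have := delta_mul_mean_nbrs_ge1 sd; lra.
move: card_le; rewrite sumr_const -[_ *+ #|t|]mulr_natl.
case: E_pseudorandom => nbrs_near _ _; have := nbrs_near s sd; rewrite ler_norml => /andP[].
lra.
Qed.

Lemma degree_in_le_large s C u : (d <= #|s|)%N -> u \notin s -> C \subset common_nbrs E s ->
  degree_in R (adj E) C u <= delta * q d.
Proof.
move=> ds us Cs; apply: le_trans (degree_in_le _ _ Cs) (common_nbrs_le_large _).
by rewrite cardsU1 us.
Qed.

Section LinkSides.
Variables (eps : R) (s t : {set 'I_n}).
Let rel_err := (6 * d%:R + 1) * delta.
Hypotheses (d_gt0 : (0 < d)%N) (rel_err_le : 4 * rel_err <= eps) (eps_le : eps <= 8^-1).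
Hypotheses (st_disjoint : [disjoint s & t]) (s_le : (#|s| <= d)%N).
Hypotheses (t_ge : (d <= #|t|)%N) (t_le : (#|t| <= 2 * d)%N).
Let A := separated_nbrs E s t.
Let B := separated_nbrs E t s.
Local Notation D := (expected_degree p A B).

Let rel_err_ge : 7 * delta <= rel_err.
Proof.
have d_ge1 : 1 <= d%:R :> R by rewrite ler1n.
by rewrite ler_wpM2r //; lra.
Qed.
Let rel_err_ge0 : 0 <= rel_err. Proof. by apply: le_trans rel_err_ge; rewrite mulr_ge0. Qed.
Let eps_ge0 : 0 <= eps. Proof. by apply: le_trans rel_err_le; rewrite mulr_ge0. Qed.

Lemma delta_mul_le_eps (x : R) : 0 <= x -> 28 * (delta * x) <= eps * x.
Proof.
by move=> x_ge0; rewrite mulrA ler_wpM2r //; move: rel_err_ge rel_err_le; lra.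
Qed.

Lemma separated_nbrs_near r (r' : {set 'I_n}) :
  (#|r| <= d)%N -> (#|r'| <= 2 * d)%N -> [disjoint r & r'] ->
  `|#|separated_nbrs E r r'|%:R - q #|r| | <= rel_err * q #|r|.
Proof.
move=> rd r'd dis; have := separated_nbrs_le r' rd; have := separated_nbrs_ge rd dis.
have err_le : (3 * #|r'|%:R + 1) * delta * q #|r| <= rel_err * q #|r|.
  have r'_le : #|r'|%:R <= 2 * d%:R :> R by rewrite -natrM ler_nat.
  by do 2!rewrite ler_wpM2r //; lra.
have : delta * q #|r| <= rel_err * q #|r|.
  by rewrite ler_wpM2r //; move: delta_ge0 rel_err_ge; lra.
by rewrite ler_norml => *; apply/andP; split; lra.
Qed.

Lemma mean_nbrs_le_separated r (r' : {set 'I_n}) :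
  (#|r| <= d)%N -> (#|r'| <= 2 * d)%N -> [disjoint r & r'] ->
  q #|r| <= 2 * #|separated_nbrs E r r'|%:R.
Proof.
move=> rd r'd dis; have := separated_nbrs_near rd r'd dis; rewrite ler_norml => /andP[+ _].
have : rel_err * q #|r| <= 2^-1 * q #|r|.
  by rewrite ler_wpM2r //; move: rel_err_le eps_le; lra.
lra.
Qed.

Let q_le_A : q #|s| <= 2 * #|A|%:R. Proof. exact: mean_nbrs_le_separated. Qed.

Lemma separated_nbrs_neq0 : A != set0.
Proof.
by rewrite -card_gt0 -(ltr0n R); move: q_le_A (mean_nbrs_gt0 s_le); lra.
Qed.

Let D_ge0 : 0 <= D. Proof. by rewrite addr_ge0 // mulr_ge0. Qed.

Lemma quasirandom_pair_separated : q d <= 2 * D ->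
  (forall u, u \in A -> `|degree_in R (adj E) A u - p * #|A|%:R| <= eps * D) ->
  (forall g, `|centred_form (adj E) p A g| <= eps * D * \sum_(u in A) g u ^+ 2) ->
  quasirandom_pair (adj E) p eps A B.
Proof.
move=> qd_le degAA formAA; have := delta_mul_le_eps (ler0n _ #|A|); have := delta_mul_le_eps D_ge0.
have := ler_wpM2l delta_ge0 qd_le; have := ler_wpM2l delta_ge0 q_le_A.
have := ler_wpM2l delta_ge0 (q_le s_le) => qdA qsA qdD epsD epsA.
split=> // [u uA|v vB|v vB].
- apply: le_trans (degree_in_le_large t_ge _ (separated_nbrs_sub E t s)) _.
    exact: separated_nbrs_notin_r uA.
  by move: (mulr_ge0 delta_ge0 D_ge0); lra.
- apply: le_trans (degree_in_le_large t_ge _ (separated_nbrs_sub E t s)) _.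
    exact: separated_nbrs_notin_l vB.
  by move: (mulr_ge0 delta_ge0 (ler0n R #|A|)); lra.
- apply: le_trans (degree_in_le _ _ (separated_nbrs_sub E s t)) _.
  apply: le_trans (common_nbrsU1_le s_le (separated_nbrs_notin_r vB)) _.
  by move: (mulr_ge0 delta_ge0 (ler0n R #|A|)); lra.
Qed.

Lemma quasirandom_pair_small_side : (#|s| < d)%N -> quasirandom_pair (adj E) p eps A B.
Proof.
move=> s_lt; have qS_le : q #|s|.+1 <= 2 * (p * #|A|%:R).
  by rewrite mean_nbrsS [leRHS]mulrCA ler_wpM2l.
have pA_le : p * #|A|%:R <= D by rewrite /expected_degree lerDl.
apply: quasirandom_pair_separated => [|u uA|].
- by move: (q_le s_lt) qS_le pA_le; lra.
- have us := separated_nbrs_notin_l uA; have ut := separated_nbrs_notin_r uA.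
  have ust_disjoint : [disjoint u |: s & t].
    by rewrite disjoints_subset subUset sub1set inE ut -disjoints_subset.
  have := @separated_nbrs_near (u |: s) t; rewrite cardsU1 us separated_nbrsU1.
  move=> /(_ s_lt t_le ust_disjoint) deg_near.
  have : `|p * #|A|%:R - q #|s|.+1| <= rel_err * q #|s|.+1.
    rewrite mean_nbrsS -mulrBr normrM (gtr0_norm p_gt0) mulrCA ler_wpM2l //.
    exact: separated_nbrs_near.
  have : rel_err * q #|s|.+1 <= rel_err * (2 * (p * #|A|%:R)) by rewrite ler_wpM2l.
  have : 4 * rel_err * (p * #|A|%:R) <= eps * D.
    by apply: ler_pM; rewrite // mulr_ge0.
  move: deg_near; rewrite /degree_in !ler_norml => /andP[? ?] ? ? /andP[? ?].
  by apply/andP; split; lra.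
- apply: centred_form_le_subset (separated_nbrs_sub E s t) _ => f.
  case: E_pseudorandom => _ _ form_le; apply: le_trans (form_le s f s_lt) _.
  rewrite ler_wpM2r ?sumr_ge0 // => [*|]; first exact: sqr_ge0.
  have := ler_wpM2l delta_ge0 qS_le; have := ler_wpM2l delta_ge0 pA_le.
  by move: (delta_mul_le_eps D_ge0) (mulr_ge0 delta_ge0 D_ge0); lra.
Qed.

Lemma quasirandom_pair_balanced : #|s| = d -> #|t| = d -> quasirandom_pair (adj E) p eps A B.
Proof.
move=> s_eq t_eq; have qd_le : q d <= 2 * D.
  apply: le_trans (_ : 2 * #|B|%:R <= _); last first.
    by rewrite ler_pM2l // /expected_degree lerDr mulr_ge0.
  by rewrite -{1}t_eq mean_nbrs_le_separated ?t_eq ?s_eq ?leq_pmull // disjoint_sym.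
have deg_le u : u \in A -> degree_in R (adj E) A u <= delta * q d.
  move=> uA; apply: degree_in_le_large (separated_nbrs_sub E s t); rewrite ?s_eq //.
  exact: separated_nbrs_notin_l uA.
have pA_le : p * #|A|%:R <= delta * (2 * q d).
  apply: ler_pM => //; apply: le_trans (separated_nbrs_le t s_le) _; rewrite s_eq.
  by rewrite ler_wpM2r //; move: delta_le1; lra.
have := ler_wpM2l delta_ge0 qd_le; have := delta_mul_le_eps D_ge0.
have := mulr_ge0 delta_ge0 D_ge0 => deltaD_ge0 epsD deltaD.
apply: quasirandom_pair_separated => // [u uA|g].
  have := deg_le u uA; have := degree_in_ge0 R (adj E) A u.
  have : 0 <= p * #|A|%:R by rewrite mulr_ge0.
  by rewrite ler_norml => *; apply/andP; split; lra.
have norm_ge0 : 0 <= \sum_(u in A) g u ^+ 2 by apply: sumr_ge0 => *; apply: sqr_ge0.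
apply: le_trans (centred_form_le_degree (adj_sym E) A g p_ge0) _.
apply: le_trans (lerD (sum_degree_in_le g deg_le) (lexx _)) _.
by rewrite -mulrDl ler_wpM2r //; lra.
Qed.

Lemma quasirandom_pair_link : (#|s| < d)%N || (#|t| == d) ->
  quasirandom_pair (adj E) p eps A B.
Proof.
have [s_lt _|ds /eqP t_eq] := ltnP #|s| d; first exact: quasirandom_pair_small_side.
by apply: quasirandom_pair_balanced => //; apply/eqP; rewrite eqn_leq s_le.
Qed.
End LinkSides.
End PseudorandomLinks.

Section PseudorandomHomology.
Variables (R : realFieldType) (n : nat) (E : {set {set 'I_n}}) (p delta : R) (d k : nat).
Hypotheses (d_gt0 : (0 < d)%N) (k_range : (2 * d - 1 <= k <= 2 * d)%N).
Hypotheses (p_gt0 : 0 < p) (p_le_delta : p <= delta).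
(* This is [4 (6 d + 1) delta <= eps], where [(6 d + 1) delta] is the relative error of the
   neighbour counts and [4 eps] is below Garland's threshold [1 / (k + 1)]. *)
Hypothesis delta_le : 32 * (6 * d%:R + 1) * d.+1%:R * delta <= 1.
Hypothesis delta_mean_ge1 : 1 <= delta * mean_nbrs n p d.
Hypothesis E_pseudorandom : pseudorandom E p delta d.
Let eps : R := (8 * d.+1%:R)^-1.

Lemma small_side_exists F : F \in faces (Zt E) k ->
  exists b, [/\ (#|side b F| <= d)%N, (d <= #|side (~~ b) F|)%N, (#|side (~~ b) F| <= 2 * d)%N &
    (#|side b F| < d)%N || (#|side (~~ b) F| == d)].
Proof.
have split_sizes a b : (a + b = k)%N -> (a <= b)%N ->
    [/\ (a <= d)%N, (d <= b)%N, (b <= 2 * d)%N & (a < d)%N || (b == d)].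
  by clear -k_range d_gt0; split; lia.
case/facesP => _ cF; have := card_side F; rewrite cF => card_sides.
have [le|lt] := leqP #|side false F| #|side true F|; [exists false|exists true].
  exact: split_sizes.
by apply: split_sizes (ltnW lt); rewrite addnC.
Qed.

Let eps_gt0 : 0 < eps. Proof. by rewrite invr_gt0 mulr_gt0. Qed.
Let eps_le : eps <= 8^-1.
Proof. by rewrite lef_pV2 ?posrE ?mulr_gt0 // ler_peMr // ler1n. Qed.

Lemma link_sides_quasirandom F : F \in faces (Zt E) k -> exists2 b,
  link_side E F b != set0 &
  quasirandom_pair (adj E) p eps (link_side E F b) (link_side E F (~~ b)).
Proof.
move=> FF; have /facesP[FZ _] := FF; have [b [s_le t_ge t_le st]] := small_side_exists FF.
have delta_ge0 : 0 <= delta by apply: le_trans p_le_delta; apply: ltW.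
have err_le : 4 * ((6 * d%:R + 1) * delta) <= eps.
  rewrite /eps -[leRHS]mul1r ler_pdivlMr ?mulr_gt0 // (le_trans _ delta_le) // le_eqVlt.
  by apply/predU1l; ring.
have delta_le1 : delta <= 1.
  have : 1 * delta <= (6 * d%:R + 1) * delta by rewrite ler_wpM2r // lerDr mulr_ge0.
  by move: err_le eps_le; lra.
have sides_disjoint := side_disjoint b FZ.
exists b; first exact: (separated_nbrs_neq0 p_gt0 p_le_delta delta_le1 delta_mean_ge1
  E_pseudorandom d_gt0 err_le eps_le sides_disjoint s_le t_le).
rewrite /link_side negbK; exact: (quasirandom_pair_link p_gt0 p_le_delta delta_le1
  delta_mean_ge1 E_pseudorandom d_gt0 err_le eps_le sides_disjoint s_le t_ge t_le st).
Qed.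

Let face_neq0 F : F \in faces (Zt E) k -> F != set0.
Proof. by move=> /facesP[_ cF]; rewrite -card_gt0 cF; move: k_range d_gt0; lia. Qed.

Lemma link_vertex_degree_gt0 F x : F \in faces (Zt E) k -> x \in link (Zt E) F ->
  (0 < #|link (Zt E) (x |: F)|)%N.
Proof.
move=> FF; have /facesP[FZ _] := FF; have [b A_neq0 AB_qr] := link_sides_quasirandom FF.
case: x => i c; rewrite mem_link // -(ltr0n R) => ic; rewrite (card_linkU1 FZ) ?face_neq0 //.
have [cE|cb] := eqVneq c b.
  by rewrite cE in ic *; apply: (twisted_degree_left_gt0 p_gt0 eps_le A_neq0 AB_qr).
have cE : c = ~~ b by move: cb; case: (c) (b) => -[].
by rewrite cE negbK in ic *; apply: (twisted_degree_right_gt0 eps_le A_neq0 AB_qr).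
Qed.

Theorem pseudorandom_homology_vanishes : homology_vanishes (Zt E) k.
Proof.
apply: (@garland _ _ (Zt_complex E) R k (4 * eps)).
- have -> : 4 * eps = (2 * d.+1%:R)^-1 by rewrite /eps !invfM mulrA; congr (_ * _); lra.
  rewrite ltr_pdivrMr ?mulr_gt0 // mul1r -natrM ltr_nat; move: k_range; lia.
- move=> F f FF; have /facesP[FZ _] := FF.
  have [b A_neq0 AB_qr] := link_sides_quasirandom FF.
  rewrite !(link_degree_sum_Zt FZ (face_neq0 FF) b) (link_form_Zt FZ (face_neq0 FF) b).
  exact: (twisted_form_le (adj_sym E) p_gt0 eps_gt0 eps_le A_neq0 AB_qr).
- by move: k_range d_gt0; lia.
move=> s sF; have /facesP[_ cs] := sF; have /card_gt0P[x xs] : (0 < #|s|)%N by rewrite cs.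
rewrite -(setD1K xs); apply: link_vertex_degree_gt0.
  exact: facesD1 (Zt_complex E) sF xs.
by rewrite inE setD1K // setD11; case/facesP: sF.
Qed.
End PseudorandomHomology.

(** * Moments of random graphs *)

Lemma bin_le_exp m k : ('C(m, k) <= m ^ k)%N.
Proof.
elim: m k => [|m IH] [|k]; rewrite ?bin0 ?bin0n ?expn0 //.
rewrite binS (leq_trans (leq_add (IH _) (IH _))) // !expnS addnC -mulSn leq_mul //.
by case: k => // k; rewrite leq_exp2r.
Qed.

Lemma card_set_seq (T : finType) (x : seq T) : #|[set y in x]| = size (undup x).
Proof.
by rewrite cardsE -(card_uniqP (undup_uniq x)); apply: eq_card => e; rewrite mem_undup.
Qed.

Lemma size_undup_repeated (T : eqType) (x : seq T) :
  all (fun e => count_mem e x != 1)%N x -> (2 * size (undup x) <= size x)%N.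
Proof.
move=> /allP repeated; rewrite -[leqRHS](perm_size (perm_count_undup x)).
rewrite size_flatten /shape -map_comp sumnE big_map mulnC -sum1_size big_distrl /=.
rewrite big_seq [leqRHS]big_seq; apply: leq_sum => e; rewrite mem_undup => ex /=.
by rewrite size_nseq mul1n ltn_neqAle eq_sym repeated // -has_count has_pred1.
Qed.

Lemma prod_natb (R : pzSemiRingType) (T : Type) (x : seq T) (P : pred T) :
  \prod_(w <- x) (P w)%:R = (all P x)%:R :> R.
Proof. by elim: x => [|w x IH]; rewrite ?big_nil ?big_cons //= IH -natrM mulnb. Qed.

Section TupleSums.
Variable T : finType.
Implicit Types (x : seq T) (U : {set T}).

Lemma sum_tuple0 (M : nmodType) (g : seq T -> M) : \sum_(x : 0.-tuple T) g x = g [::].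
Proof.
rewrite (eq_bigr (fun=> g [::])) => [|x _]; last by rewrite tuple0.
by rewrite sumr_const card_tuple expn0 mulr1n.
Qed.

Lemma sum_tuple_cons (M : nmodType) l (g : seq T -> M) :
  \sum_(x : l.+1.-tuple T) g x = \sum_w \sum_(y : l.-tuple T) g (w :: y).
Proof.
rewrite pair_bigA /= (reindex (fun wy : T * l.-tuple T => cons_tuple wy.1 wy.2)) //.
exists (fun x : l.+1.-tuple T => (thead x, [tuple of behead x])) => [[w y] _|x _] /=.
  by congr pair; apply: val_inj.
by rewrite [x in RHS]tuple_eta; apply: val_inj.
Qed.

Lemma expr_sum_tuple (R : pzSemiRingType) l (a : T -> R) :
  (\sum_w a w) ^+ l = \sum_(x : l.-tuple T) \prod_(w <- x) a w.
Proof.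
elim: l => [|l IH]; first by rewrite (sum_tuple0 (fun x => \prod_(w <- x) a w)) big_nil.
rewrite (sum_tuple_cons l (fun x => \prod_(w <- x) a w)) exprS mulr_suml.
by apply: eq_bigr => w _; rewrite IH mulr_sumr; apply: eq_bigr => y _; rewrite big_cons.
Qed.

Lemma sum_tuple_all (R : pzSemiRingType) l U :
  \sum_(x : l.-tuple T) (all (mem U) x)%:R = #|U|%:R ^+ l :> R.
Proof.
under eq_bigr do rewrite -prod_natb.
rewrite -expr_sum_tuple -sum1_card natr_sum [in RHS]big_mkcond; congr (_ ^+ _).
by apply: eq_bigr => w _ /=; case: (w \in U).
Qed.

Section Bounds.
Variable R : numDomainType.

Lemma sum_set_by_card_le l (c : nat -> R) (K : R) :
  (forall u, (u <= l)%N -> 0 <= c u) -> (forall u, (u <= l)%N -> #|T|%:R ^+ u * c u <= K) ->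
  \sum_(U : {set T} | (#|U| <= l)%N) c #|U| <= l.+1%:R * K.
Proof.
move=> c_ge0 c_le; rewrite (partition_big (fun U => inord #|U| : 'I_l.+1) xpredT) //=.
apply: le_trans (_ : \sum_(u < l.+1) K <= _).
  apply: ler_sum => u _; have ul : (u <= l)%N by rewrite -ltnS.
  rewrite (eq_bigl (fun U => U \in [set U : {set T} | #|U| == u])) => [|U]; last first.
    rewrite inE; apply/andP/eqP => [[Ul /eqP <-]|->]; first by rewrite inordK.
    by rewrite ul inord_val.
  rewrite (eq_bigr (fun=> c u)) => [|U]; last by rewrite inE => /eqP->.
  rewrite sumr_const card_draws -[leLHS]mulr_natl; apply: le_trans (c_le u ul).
  by rewrite ler_wpM2r ?c_ge0 // -natrX ler_nat bin_le_exp.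
by rewrite sumr_const card_ord -[leLHS]mulr_natl.
Qed.

Definition tuple_bound l : R := l.+1%:R * l%:R ^+ l.

Lemma tuple_bound_ge0 l : 0 <= tuple_bound l.
Proof. by rewrite mulr_ge0 ?exprn_ge0. Qed.

Lemma sum_tuple_by_card_le l (c : nat -> R) (K : R) :
  (forall u, (u <= l)%N -> 0 <= c u) -> (forall u, (u <= l)%N -> #|T|%:R ^+ u * c u <= K) ->
  \sum_(x : l.-tuple T) c (size (undup x)) <= tuple_bound l * K.
Proof.
move=> c_ge0 c_le.
rewrite (partition_big (fun x : l.-tuple T => [set y in x]) (fun U => #|U| <= l)%N) /=; last first.
  by move=> x _; rewrite cardsE (leq_trans (card_size _)) // size_tuple.
apply: le_trans (_ : \sum_(U : {set T} | (#|U| <= l)%N) l%:R ^+ l * c #|U| <= _).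
  apply: ler_sum => U Ul.
  apply: le_trans (_ : \sum_(x : l.-tuple T) (all (mem U) x)%:R * c #|U| <= _).
    rewrite big_mkcond; apply: ler_sum => x _.
    case: eqP => [xU|_]; last by rewrite mulr_ge0 ?c_ge0.
    rewrite -card_set_seq xU (_ : all _ _ = true) ?mul1r //.
    by apply/allP => y yx; rewrite -xU !inE.
  by rewrite -mulr_suml sum_tuple_all ler_wpM2r ?c_ge0 // lerXn2r ?nnegrE // ler_nat.
rewrite /tuple_bound -mulrA; apply: (sum_set_by_card_le (c := fun u => l%:R ^+ l * c u)) => u ul.
  by rewrite mulr_ge0 ?exprn_ge0 ?c_ge0.
by rewrite mulrCA ler_wpM2l ?exprn_ge0 ?c_le.
Qed.
End Bounds.
End TupleSums.

Section Expectation.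
Variables (R : realType) (n : nat) (p : R).
Local Notation graph := {set {set 'I_n}}.
Implicit Types (E H : graph) (F : graph -> R) (es : seq {set 'I_n}).

Definition expectation F : R := \sum_(E : graph | is_graph E) ER_weight p E * F E.

Lemma eq_expectation F F' : F =1 F' -> expectation F = expectation F'.
Proof. by move=> FF'; apply: eq_bigr => E _; rewrite FF'. Qed.

Lemma expectationD F F' :
  expectation (fun E => F E + F' E) = expectation F + expectation F'.
Proof. by rewrite -big_split; apply: eq_bigr => E _; rewrite mulrDr. Qed.

Lemma expectationZ c F : expectation (fun E => c * F E) = c * expectation F.
Proof. by rewrite mulr_sumr; apply: eq_bigr => E _; rewrite mulrCA. Qed.

Lemma expectation_sum (I : finType) (P : pred I) (F : I -> graph -> R) :
  expectation (fun E => \sum_(i | P i) F i E) = \sum_(i | P i) expectation (F i).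
Proof. by rewrite exchange_big; apply: eq_bigr => E _; rewrite mulr_sumr. Qed.

Lemma ER_weight_prod E : is_graph E ->
  ER_weight p E = \prod_(e in all_pairs n) if e \in E then p else 1 - p.
Proof.
move=> graphE.
have -> : ER_weight p E = p ^+ #|E| * (1 - p) ^+ #|all_pairs n :\: E|.
  by rewrite cardsD (setIidPr graphE) /all_pairs card_draws card_ord.
rewrite (big_setID E) /= (setIidPr graphE) -!prodr_const; congr (_ * _).
  by apply: eq_bigr => e ->.
by apply: eq_bigr => e; rewrite inE => /andP[/negPf -> _].
Qed.

Lemma expectation_prod (g : {set 'I_n} -> bool -> R) :
  expectation (fun E => \prod_(e in all_pairs n) g e (e \in E)) =
  \prod_(e in all_pairs n) (p * g e true + (1 - p) * g e false).
Proof.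
pose present e := if e \in all_pairs n then p * g e true else 0.
pose absent e := if e \in all_pairs n then (1 - p) * g e false else 1.
transitivity (\prod_e (present e + absent e)); last first.
  rewrite [RHS]big_mkcond; apply: eq_bigr => e _; rewrite /present /absent.
  by case: ifP; rewrite ?add0r.
rewrite (bigA_distr 1 _ present absent) /expectation big_mkcond; apply: eq_bigr => E _.
case: ifPn => [graphE|/subsetPn[e eE eP]].
  rewrite ER_weight_prod // -big_split big_mkcond; apply: eq_bigr => e _ /=.
  rewrite /present /absent; case: ifPn => [_|eP]; first by case: (e \in E).
  by rewrite ifN //; apply: contra eP; apply: (subsetP graphE).
by rewrite (bigD1 e) //= eE /present (negPf eP) mul0r.
Qed.

Definition centred_edge_moment c : R := p * (1 - p) ^+ c + (1 - p) * (- p) ^+ c.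

Lemma expectation_centred_edges es H : {subset es <= all_pairs n} -> H \subset all_pairs n ->
    {in es, forall e, e \notin H} ->
  expectation (fun E => (\prod_(e <- es) ((e \in E)%:R - p)) * (H \subset E)%:R) =
  \prod_(e <- undup es) centred_edge_moment (count_mem e es) * p ^+ #|H|.
Proof.
move=> esP HP esH.
pose g e (b : bool) : R := (b%:R - p) ^+ count_mem e es * (if e \in H then b%:R else 1).
transitivity (expectation (fun E => \prod_(e in all_pairs n) g e (e \in E))).
  apply: eq_expectation => E; rewrite /g big_split; congr (_ * _) => /=.
    rewrite -prodr_undup_exp_count big_uniq ?undup_uniq // big_mkcond [RHS]big_mkcond /=.
    apply: eq_bigr => e _; rewrite mem_undup; case: (boolP (e \in es)) => [/esP -> //|ne].
    by rewrite (count_memPn ne) expr0 if_same.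
  have [/subsetP HE|/subsetPn[e eH eE]] := boolP (H \subset E).
    by rewrite big1 // => e _; case: ifP => // /HE ->.
  by rewrite (bigD1 e) ?(subsetP HP) //= eH (negPf eE) mul0r.
have momentH e : e \in H -> p * g e true + (1 - p) * g e false = p.
  move=> eH; have ne : e \notin es by apply: contraL eH; apply: esH.
  by rewrite /g (count_memPn ne) eH !expr0 !mul1r mulr1 mulr0 addr0.
have momentN e : e \notin H ->
    p * g e true + (1 - p) * g e false = centred_edge_moment (count_mem e es).
  by move=> /negPf eH; rewrite /g eH !mulr1 sub0r.
rewrite expectation_prod (big_setID H) /= (setIidPr HP) (eq_bigr _ momentH) prodr_const mulrC.
congr (_ * _); rewrite [RHS]big_uniq ?undup_uniq // big_mkcond [RHS]big_mkcond /=.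
apply: eq_bigr => e _; rewrite mem_undup inE; case: (boolP (e \in es)) => [ees|ne].
  by rewrite esH ?esP //= momentN ?esH.
case: ifP => // /andP[/momentN -> _].
by rewrite (count_memPn ne) /centred_edge_moment !expr0 !mulr1 addrC subrK.
Qed.

Hypotheses (p_ge0 : 0 <= p) (p_le1 : p <= 1).

Lemma ER_weight_ge0 E : 0 <= ER_weight p E.
Proof. by rewrite mulr_ge0 // exprn_ge0 // subr_ge0. Qed.

Lemma ER_prob_le_expectation (P : graph -> Prop) F :
  (forall E, 0 <= F E) -> (forall E, P E -> 1 <= F E) -> ER_prob p P <= expectation F.
Proof.
move=> F_ge0 F_ge1; rewrite /ER_prob big_mkcondr; apply: ler_sum => E _.
case: asboolP => [/F_ge1|_]; last by rewrite mulr_ge0 ?ER_weight_ge0.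
by apply: ler_peMr; exact: ER_weight_ge0.
Qed.

Lemma centred_edge_moment1 : centred_edge_moment 1 = 0.
Proof. by rewrite /centred_edge_moment; ring. Qed.

Lemma centred_edge_moment_le c : (1 < c)%N -> `|centred_edge_moment c| <= p.
Proof.
move=> c_gt1; have [q_ge0 q_le1] : 0 <= 1 - p /\ 1 - p <= 1 by split; move: p_ge0 p_le1; lra.
have q_le : (1 - p) ^+ c <= 1 - p by rewrite ler_iXnr // ltnW.
have p_le : p ^+ c <= p ^+ 2 by rewrite ler_wiXn2l.
apply: le_trans (ler_normD _ _) _.
rewrite (normrM p) (normrM (1 - p)) !normrX normrN !(ger0_norm p_ge0) !(ger0_norm q_ge0).
have := ler_wpM2l p_ge0 q_le; have := ler_wpM2l q_ge0 p_le; have := exprn_ge0 3 p_ge0.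
rewrite !exprS; lra.
Qed.

Lemma expectation_centred_edges_le es H :
    {subset es <= all_pairs n} -> H \subset all_pairs n -> {in es, forall e, e \notin H} ->
  `|expectation (fun E => (\prod_(e <- es) ((e \in E)%:R - p)) * (H \subset E)%:R)| <=
  if (2 * size (undup es) <= size es)%N then p ^+ (size (undup es) + #|H|) else 0.
Proof.
move=> esP HP esH; rewrite expectation_centred_edges // normrM normr_prod ger0_norm ?exprn_ge0 //.
have [repeated|/allPn[e ees /negPn/eqP count1]] := boolP (all (fun e => count_mem e es != 1)%N es).
  rewrite size_undup_repeated // exprD ler_wpM2r ?exprn_ge0 //.
  have <- : \prod_(e <- undup es) p = p ^+ size (undup es).
    by rewrite big_const_seq count_predT iter_mulr_1.
  rewrite big_seq [leRHS]big_seq; apply: ler_prod => e; rewrite mem_undup => ees.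
  rewrite normr_ge0 centred_edge_moment_le // ltn_neqAle eq_sym (allP repeated) //.
  by rewrite -has_count has_pred1.
rewrite (bigD1_seq e) ?mem_undup ?undup_uniq //= count1 centred_edge_moment1 normr0 !mul0r.
by case: ifP; rewrite ?exprn_ge0.
Qed.
End Expectation.

Lemma ler_eXn2 (R : realDomainType) (x y : R) k m :
  0 <= x -> x <= y -> 1 <= y -> (k <= m)%N -> x ^+ k <= y ^+ m.
Proof.
move=> x_ge0 xy y_ge1 km; apply: le_trans (_ : y ^+ k <= _); last by rewrite ler_weXn2l.
by rewrite lerXn2r ?nnegrE // (le_trans x_ge0).
Qed.

Section NeighbourEdges.
Variable n : nat.
Implicit Types (U s : {set 'I_n}) (E : {set {set 'I_n}}) (x : seq 'I_n).

Definition edges_between U s : {set {set 'I_n}} := [set [set wz.1; wz.2] | wz in setX U s].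

Lemma edges_betweenP U s e :
  reflect (exists w z, [/\ w \in U, z \in s & e = [set w; z]]) (e \in edges_between U s).
Proof.
apply: (iffP imsetP) => [[[w z]]|[w [z [wU zs ->]]]].
  by rewrite inE /= => /andP[wU zs] ->; exists w, z.
by exists (w, z); rewrite // inE wU.
Qed.

Lemma card_edges_between U s : [disjoint U & s] -> #|edges_between U s| = (#|U| * #|s|)%N.
Proof.
move=> Us; rewrite -cardsX card_in_imset // => -[w z] [w' z']; rewrite !inE /=.
move=> /andP[wU zs] /andP[wU' zs'] e; congr pair.
  have : w \in [set w'; z'] by rewrite -e !inE eqxx.
  by case/set2P => // wz; rewrite wz (disjointFl Us zs') in wU.
have : z \in [set w'; z'] by rewrite -e !inE eqxx orbT.
by case/set2P => // zw; rewrite zw (disjointFr Us wU') in zs.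
Qed.

Lemma edges_between_pairs U s : [disjoint U & s] -> edges_between U s \subset all_pairs n.
Proof.
move=> Us; apply/subsetP => e /edges_betweenP[w [z [wU zs ->]]]; rewrite inE cards2.
by rewrite (contraTneq _ wU) // => ->; rewrite (disjointFl Us zs).
Qed.

Lemma all_common_nbrs E s x : all (fun w => w \notin s) x ->
  all (mem (common_nbrs E s)) x = (edges_between [set w in x] s \subset E).
Proof.
move=> /allP xs; apply/allP/subsetP => [nbr e /edges_betweenP[w [z []]]|sub w wx].
  by rewrite inE => /nbr/common_nbrsP adjw /adjw /andP[_ wzE] ->.
apply/common_nbrsP => z zs; rewrite /adj sub ?andbT; last first.
  by apply/edges_betweenP; exists w, z; rewrite inE.
by apply: contraNneq (xs w wx) => ->.
Qed.
End NeighbourEdges.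

Definition edge_seq (T : finType) (r : seq (T * T)) : seq {set T} :=
  [seq [set ij.1; ij.2] | ij <- r].

Section CentredEdges.
Variables (R : realType) (n : nat) (p : R).
Implicit Types (E : {set {set 'I_n}}) (s : {set 'I_n}) (x y : seq 'I_n) (r : seq ('I_n * 'I_n)).

Definition centred_edge E i j : R := if i != j then ([set i; j] \in E)%:R - p else 0.

Lemma prod_centred_edge E r : \prod_(ij <- r) centred_edge E ij.1 ij.2 =
  (all (fun ij => ij.1 != ij.2) r)%:R * \prod_(e <- edge_seq r) ((e \in E)%:R - p).
Proof.
rewrite big_map -prod_natb -big_split; apply: eq_bigr => ij _ /=.
by rewrite /centred_edge; case: (_ != _); rewrite ?mul1r ?mul0r.
Qed.

Hypotheses (p_ge0 : 0 <= p) (p_le1 : p <= 1).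

Lemma expectation_nbrs_edges_le s x r :
  (all (fun w => w \notin s) x -> all (fun ij => (ij.1 \notin s) && (ij.2 \notin s)) r) ->
  `|expectation p (fun E => (all (mem (common_nbrs E s)) x)%:R *
      \prod_(ij <- r) centred_edge E ij.1 ij.2)| <=
  if (2 * size (undup (edge_seq r)) <= size r)%N
  then p ^+ (size (undup (edge_seq r)) + size (undup x) * #|s|) else 0.
Proof.
set term := fun E => _; set bound := if _ then _ else _ => r_out.
have bound_ge0 : 0 <= bound by rewrite /bound; case: ifP; rewrite ?exprn_ge0.
have term_eq0 : (forall E, term E = 0) -> `|expectation p term| <= bound.
  by move=> t0; rewrite /expectation big1 ?normr0 // => E _; rewrite t0 mulr0.
have [x_out|/allPn[w wx ws]] := boolP (all (fun w => w \notin s) x); last first.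
  apply: term_eq0 => E; rewrite /term (_ : all _ _ = false) ?mul0r //.
  by apply: contraNF ws => /allP/(_ w wx); apply: common_nbrs_notin.
have [r_neq|r_eq] := boolP (all (fun ij => ij.1 != ij.2) r); last first.
  by apply: term_eq0 => E; rewrite /term prod_centred_edge (negPf r_eq) mul0r mulr0.
have disj : [disjoint [set w in x] & s].
  by apply/pred0P => w; rewrite /= inE; apply/negP => /andP[/(allP x_out)/negP].
have termE E : term E =
    (\prod_(e <- edge_seq r) ((e \in E)%:R - p)) * (edges_between [set w in x] s \subset E)%:R.
  by rewrite /term all_common_nbrs // prod_centred_edge r_neq mul1r mulrC.
rewrite (eq_expectation p termE) /bound -(card_set_seq x) -card_edges_between //.
rewrite -(size_map (fun ij => [set ij.1; ij.2]) r).
apply: expectation_centred_edges_le => //; last 1 first.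
- move=> e /mapP[ij ij_r ->]; have /andP[i_out j_out] := allP (r_out x_out) ij ij_r.
  apply/negP => /edges_betweenP[w [z [_ zs eE]]].
  have : z \in [set ij.1; ij.2] by rewrite eE !inE eqxx orbT.
  by case/set2P => zE; rewrite zE in zs; rewrite zs in i_out j_out.
- by move=> e /mapP[ij /(allP r_neq) ij_neq ->]; rewrite inE cards2 ij_neq.
- exact: edges_between_pairs.
Qed.

Definition nbr_deviation E s v : R :=
  \sum_w (w \in common_nbrs E s)%:R * centred_edge E v w.

Lemma expectation_nbr_deviation_le s v m (Q : R) :
  v \notin s -> 1 <= Q -> mean_nbrs n p #|s|.+1 <= Q ->
  expectation p (fun E => nbr_deviation E s v ^+ (2 * m)) <= tuple_bound R (2 * m) * Q ^+ m.
Proof.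
move=> vs Q_ge1 mean_le; have Q_ge0 : 0 <= Q by apply: le_trans Q_ge1.
pose c u : R := if (u <= m)%N then p ^+ (u + u * #|s|) else 0.
have c_ge0 u : 0 <= c u by rewrite /c; case: ifP; rewrite ?exprn_ge0.
under eq_expectation => E do rewrite expr_sum_tuple.
rewrite expectation_sum.
apply: le_trans (_ : \sum_(x : (2 * m).-tuple 'I_n) c (size (undup x)) <= _); last first.
  apply: sum_tuple_by_card_le => // u _; rewrite /c.
  case: ifP => um; last by rewrite mulr0 exprn_ge0.
  by rewrite card_ord -mulnS mulnC exprM -exprMn ler_eXn2 ?mulr_ge0 ?exprn_ge0.
apply: ler_sum => x _; apply: le_trans (ler_norm _) _.
pose star := [seq (v, w) | w <- x].
have termE E : \prod_(w <- x) ((w \in common_nbrs E s)%:R * centred_edge E v w) =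
    (all (mem (common_nbrs E s)) x)%:R * \prod_(ij <- star) centred_edge E ij.1 ij.2.
  by rewrite big_split /= (prod_natb _ _ (fun w => w \in common_nbrs E s)) big_map.
rewrite (eq_expectation p termE); apply: le_trans (expectation_nbrs_edges_le _) _.
  by rewrite all_map; apply: sub_all => w ws; rewrite /= vs.
have edge_inj : injective (fun w => [set v; w]).
  move=> w w' eq_edge; have : w \in [set v; w'] by rewrite -eq_edge set22.
  case/set2P => // wv; have : w' \in [set v; w] by rewrite eq_edge set22.
  by rewrite wv => /set2P[] ->.
by rewrite /edge_seq -map_comp (undup_map_inj edge_inj) !size_map size_tuple leq_pmul2l.
Qed.
End CentredEdges.

Section Walks.
Variable T : finType.
Implicit Types (i j : T) (y : seq T).

Lemma mem_pairmap_pair i y ij : ij \in pairmap pair i y -> ij.1 \in i :: y /\ ij.2 \in i :: y.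
Proof.
elim: y i => // j y IH i /=; rewrite inE => /predU1P[->|/IH[i_y j_y]].
  by rewrite !inE !eqxx orbT.
by split; rewrite inE ?i_y ?j_y orbT.
Qed.

(* Each vertex visited for the first time comes with a new edge. *)
Lemma walk_vertices_le i y :
  (size (undup (i :: y)) <= (size (undup (edge_seq (pairmap pair i y)))).+1)%N.
Proof.
elim: y i => // j y IH i; rewrite [pairmap _ _ _]/= [edge_seq _]/= -/(edge_seq _).
rewrite [undup (i :: _)]/=; case: ifPn => iy.
  apply: leq_trans (IH j) _; rewrite ltnS /=; case: ifP => //= _; exact: leqnSn.
rewrite [size (i :: _)]/= ltnS; apply: leq_trans (IH j) _.
rewrite [undup (_ :: edge_seq _)]/=; case: ifP => // /mapP[ij /mem_pairmap_pair[iy' jy'] eq_edge].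
have : i \in [set ij.1; ij.2] by rewrite -eq_edge set21.
by case/set2P => iE; rewrite iE ?iy' ?jy' in iy.
Qed.
End Walks.

Section TraceWalks.
Variables (R : comPzRingType) (n : nat).
Implicit Types (M : 'M[R]_n) (i k : 'I_n).

Lemma mx_exp_walks M l i k :
  (M ^+ l) i k =
  \sum_(y : l.-tuple 'I_n) (last i y == k)%:R * \prod_(ij <- pairmap pair i y) M ij.1 ij.2.
Proof.
elim: l i => [|l IH] i.
  rewrite (sum_tuple0 (fun y => (last i y == k)%:R * \prod_(ij <- pairmap _ i y) M ij.1 ij.2)).
  by rewrite big_nil mulr1 expr0 mxE.
rewrite exprS mxE.
rewrite (sum_tuple_cons l (fun y => (last i y == k)%:R * \prod_(ij <- pairmap _ i y) M ij.1 ij.2)).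
apply: eq_bigr => j _; rewrite IH mulr_sumr; apply: eq_bigr => y _ /=.
by rewrite big_cons mulrCA.
Qed.

Definition closed_walk_weight M (x : seq 'I_n) : R :=
  if x is i :: y then (last i y == i)%:R * \prod_(ij <- pairmap pair i y) M ij.1 ij.2 else 0.

Lemma mxtrace_exp_walks M l :
  \tr (M ^+ l) = \sum_(x : l.+1.-tuple 'I_n) closed_walk_weight M x.
Proof.
by rewrite (sum_tuple_cons l (closed_walk_weight M)); apply: eq_bigr => i _; rewrite mx_exp_walks.
Qed.
End TraceWalks.

Section QuadraticForm.
Variables (R : realDomainType) (n : nat).
Implicit Types (M : 'M[R]_n) (f : 'cV[R]_n).

Definition quadratic_form M f : R := (f^T *m M *m f) 0 0.

Lemma quadratic_formE M f : quadratic_form M f = \sum_i \sum_j M i j * f i 0 * f j 0.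
Proof.
rewrite /quadratic_form -mulmxA mxE; apply: eq_bigr => i _; rewrite !mxE mulr_sumr.
by apply: eq_bigr => j _; ring.
Qed.

Lemma quadratic_form1 f : quadratic_form 1 f = \sum_i f i 0 ^+ 2.
Proof. by rewrite /quadratic_form mulmx1 mxE; apply: eq_bigr => i _; rewrite mxE expr2. Qed.

Lemma quadratic_form1_ge0 f : 0 <= quadratic_form 1 f.
Proof. by rewrite quadratic_form1 sumr_ge0 // => i _; rewrite sqr_ge0. Qed.

Lemma trmx_exp M k : M^T = M -> (M ^+ k)^T = M ^+ k.
Proof.
move=> Msym; elim: k => [|k IH]; first by rewrite expr0 trmx1.
by rewrite [in LHS]exprS -mulmxE trmx_mul IH Msym mulmxE -exprSr.
Qed.

Lemma quadratic_form_sqr M f : M^T = M -> quadratic_form (M ^+ 2) f = \sum_i (M *m f) i 0 ^+ 2.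
Proof.
move=> Msym; rewrite /quadratic_form expr2 -mulmxE mulmxA -mulmxA -{1}Msym -trmx_mul mxE.
by apply: eq_bigr => i _; rewrite mxE expr2.
Qed.

Lemma quadratic_form_cauchy_schwarz M f : M^T = M ->
  quadratic_form M f ^+ 2 <= quadratic_form 1 f * quadratic_form (M ^+ 2) f.
Proof.
move=> Msym; rewrite quadratic_form1 quadratic_form_sqr //.
have -> : quadratic_form M f = \sum_i f i 0 * (M *m f) i 0.
  by rewrite /quadratic_form -mulmxA mxE; apply: eq_bigr => i _; rewrite mxE.
exact: cauchy_schwarz_sum.
Qed.

Lemma mxtrace_sqr M : M^T = M -> \tr (M ^+ 2) = \sum_i \sum_j M i j ^+ 2.
Proof.
move=> Msym; apply: eq_bigr => i _; rewrite expr2 mxE; apply: eq_bigr => j _.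
by rewrite -{2}Msym mxE expr2.
Qed.

Lemma mxtrace_exp_even_ge0 M k : M^T = M -> 0 <= \tr (M ^+ (2 * k)).
Proof.
move=> Msym; rewrite mulnC exprM mxtrace_sqr ?trmx_exp // sumr_ge0 // => i _.
by rewrite sumr_ge0 // => j _; rewrite sqr_ge0.
Qed.

Lemma quadratic_form_sqr_le_mxtrace M f : M^T = M ->
  quadratic_form (M ^+ 2) f <= \tr (M ^+ 2) * quadratic_form 1 f.
Proof.
move=> Msym; rewrite quadratic_form_sqr // mxtrace_sqr // quadratic_form1 mulr_suml.
by apply: ler_sum => i _; rewrite mxE cauchy_schwarz_sum.
Qed.

Lemma quadratic_form_exp_le_mxtrace M f k : M^T = M ->
  quadratic_form M f ^+ (2 ^ k.+1) <= \tr (M ^+ (2 ^ k.+1)) * quadratic_form 1 f ^+ (2 ^ k.+1).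
Proof.
have form1_ge0 := quadratic_form1_ge0 f.
elim: k M => [|k IH] M Msym.
  apply: le_trans (quadratic_form_cauchy_schwarz f Msym) _.
  by rewrite mulrC expr2 mulrA ler_wpM2r ?quadratic_form_sqr_le_mxtrace.
have form_le := quadratic_form_cauchy_schwarz f Msym.
rewrite expnS !exprM.
apply: le_trans (_ : (quadratic_form 1 f * quadratic_form (M ^+ 2) f) ^+ (2 ^ k.+1) <= _).
  by rewrite lerXn2r ?nnegrE ?sqr_ge0 // (le_trans (sqr_ge0 _) form_le).
rewrite exprMn -[leRHS]mulrC [(_ ^+ 2) ^+ _]exprAC expr2 -mulrA ler_wpM2l ?exprn_ge0 // mulrC.
exact: IH (trmx_exp 2 Msym).
Qed.
End QuadraticForm.

Section TraceMoment.
Variables (R : realType) (n : nat) (p : R).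
Hypotheses (p_ge0 : 0 <= p) (p_le1 : p <= 1).
Implicit Types (E : {set {set 'I_n}}) (s : {set 'I_n}) (y : seq 'I_n).

Definition centred_adj_mx E s : 'M[R]_n :=
  \matrix_(i, j) ((i \in common_nbrs E s)%:R * (j \in common_nbrs E s)%:R * centred_edge p E i j).

Lemma centred_adj_mx_sym E s : (centred_adj_mx E s)^T = centred_adj_mx E s.
Proof.
apply/matrixP => i j; rewrite !mxE /centred_edge eq_sym setUC.
by congr (_ * _); rewrite mulrC.
Qed.

Lemma prod_centred_adj_walk E s i y :
  (i \in common_nbrs E s)%:R * \prod_(ij <- pairmap pair i y) centred_adj_mx E s ij.1 ij.2 =
  (all (mem (common_nbrs E s)) (i :: y))%:R *
  \prod_(ij <- pairmap pair i y) centred_edge p E ij.1 ij.2.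
Proof.
elim: y i => [|j y IH] i; first by rewrite !big_nil /= andbT.
rewrite /= !big_cons mxE /=; have := IH j; rewrite /=.
case: (i \in _); last by rewrite !mul0r.
case: (j \in _); last by rewrite /= !(mul0r, mulr0).
by rewrite !mul1r /= => ->; rewrite mulrCA.
Qed.

Lemma closed_walk_weight_centred E s i y : y != [::] ->
  closed_walk_weight (centred_adj_mx E s) (i :: y) = (last i y == i)%:R *
    ((all (mem (common_nbrs E s)) (i :: y))%:R *
     \prod_(ij <- pairmap pair i y) centred_edge p E ij.1 ij.2).
Proof.
case: y => // j y _; rewrite -prod_centred_adj_walk /closed_walk_weight; congr (_ * _).
by rewrite /= !big_cons mxE /=; case: (i \in _); rewrite ?mul1r ?mul0r.
Qed.

Lemma expectation_closed_walk_le s i y m : (0 < m)%N -> size y = (2 * m)%N ->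
  `|expectation p (fun E => closed_walk_weight (centred_adj_mx E s) (i :: y))| <=
  if (size (undup (i :: y)) <= m.+1)%N
  then p ^+ ((size (undup (i :: y))).-1 + size (undup (i :: y)) * #|s|) else 0.
Proof.
move=> m_gt0 sy; have y_neq0 : y != [::] by rewrite -size_eq0 sy muln_eq0 -lt0n.
under eq_expectation => E do rewrite closed_walk_weight_centred //.
rewrite expectationZ normrM normr_nat.
rewrite -[leRHS]mul1r; apply: ler_pM; rewrite ?lern1 ?leq_b1 //.
apply: le_trans (expectation_nbrs_edges_le p_ge0 p_le1 _) _.
  by move=> /allP walk_out; apply/allP => ij /mem_pairmap_pair[i_walk j_walk]; rewrite !walk_out.
rewrite size_pairmap sy leq_pmul2l //; case: ifP => edges_le; last by case: ifP; rewrite ?exprn_ge0.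
have vertices_le := walk_vertices_le i y; rewrite (leq_trans vertices_le) //.
by rewrite ler_wiXn2l // leq_add2r -subn1 leq_subLR.
Qed.

Lemma expectation_mxtrace_le s m (Q : R) :
  (0 < n)%N -> (0 < m)%N -> 1 <= Q -> mean_nbrs n p #|s|.+1 <= Q ->
  expectation p (fun E => \tr (centred_adj_mx E s ^+ (2 * m))) <=
  tuple_bound R (2 * m).+1 * (n%:R * Q ^+ m).
Proof.
move=> n_gt0 m_gt0 Q_ge1 mean_le; have Q_ge0 : 0 <= Q by apply: le_trans Q_ge1.
pose c u : R := if (u <= m.+1)%N then p ^+ (u.-1 + u * #|s|) else 0.
have c_ge0 u : 0 <= c u by rewrite /c; case: ifP; rewrite ?exprn_ge0.
under eq_expectation => E do rewrite mxtrace_exp_walks.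
rewrite expectation_sum.
apply: le_trans (_ : \sum_(x : (2 * m).+1.-tuple 'I_n) c (size (undup x)) <= _).
  apply: ler_sum => x _; apply: le_trans (ler_norm _) _.
  case: x => -[//|i y] size_walk; apply: expectation_closed_walk_le => //.
  by case/eqP: size_walk.
apply: sum_tuple_by_card_le => // u _; rewrite /c card_ord.
case: ifP => um; last by rewrite mulr0 mulr_ge0 ?exprn_ge0.
case: u um => [_|u um]; first by rewrite mul1r mulr_ege1 ?ler1n ?exprn_ege1.
have -> : (u.+1.-1 + u.+1 * #|s| = #|s| + #|s|.+1 * u)%N by rewrite mulSn mulnC; lia.
have mean_ge0 : 0 <= n%:R * p ^+ #|s|.+1 by rewrite mulr_ge0 ?exprn_ge0.
rewrite exprD exprS mulrACA exprM -exprMn ler_pM ?ler_eXn2 //.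
- by rewrite mulr_ge0 ?exprn_ge0.
- by rewrite exprn_ge0.
- by rewrite ler_piMr // exprn_ile1.
Qed.
End TraceMoment.

(** * Pseudorandomness with overwhelming probability *)

Definition concentrated (R : realType) n (E : {set {set 'I_n}}) (p gamma : R) d : Prop :=
  (forall (s : {set 'I_n}) v, (#|s| <= d)%N -> v \notin s ->
     `|nbr_deviation p E s v| <= gamma * mean_nbrs n p (minn #|s|.+1 d)) /\
  (forall (s : {set 'I_n}) (f : 'cV[R]_n), (#|s| < d)%N ->
     `|quadratic_form (centred_adj_mx p E s) f| <=
     gamma * mean_nbrs n p #|s|.+1 * quadratic_form 1 f).

Lemma cardS_setU1 (T : finType) (s : {set T}) m : #|s| = m.+1 ->
  exists v (t : {set T}), [/\ v \notin t, #|t| = m & s = v |: t].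
Proof.
move=> cs; have /card_gt0P[v vs] : (0 < #|s|)%N by rewrite cs.
exists v, (s :\ v); rewrite setD11 setD1K //; split=> //.
by move: cs; rewrite (cardsD1 v) vs => -[].
Qed.

Section ConcentratedPseudorandom.
Variables (R : realType) (n : nat) (E : {set {set 'I_n}}) (p gamma delta : R) (d : nat).
Local Notation q := (mean_nbrs n p).
Hypotheses (p_gt0 : 0 < p) (p_le_gamma : p <= gamma).
Hypotheses (gamma_le : 4 * d.+1%:R * gamma <= delta) (delta_le1 : delta <= 1).
Hypothesis gamma_qd_ge1 : 1 <= gamma * q d.
Hypothesis E_concentrated : concentrated E p gamma d.
Implicit Types (s : {set 'I_n}) (v : 'I_n) (m : nat).

Let p_ge0 : 0 <= p. Proof. exact: ltW. Qed.
Let gamma_ge0 : 0 <= gamma. Proof. exact: le_trans p_le_gamma. Qed.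
Let gamma_mul_le m : (m <= d.+1)%N -> 4 * m%:R * gamma <= delta.
Proof.
by move=> md; apply: le_trans gamma_le; rewrite ler_wpM2r // ler_wpM2l // ler_nat.
Qed.
Let p_le1 : p <= 1.
Proof. by have := @gamma_mul_le 1 isT; move: p_le_gamma gamma_ge0 delta_le1; lra. Qed.
Let q_ge0 m : 0 <= q m. Proof. exact: mean_nbrs_ge0. Qed.

Lemma nbr_deviationE s v :
  nbr_deviation p E s v = #|common_nbrs E (v |: s)|%:R - p * #|common_nbrs E s :\ v|%:R.
Proof.
have card_natr (A : {set 'I_n}) : #|A|%:R = \sum_w (w \in A)%:R :> R.
  by rewrite -sum1_card natr_sum big_mkcond; apply: eq_bigr => w _; case: (w \in A).
rewrite !card_natr mulr_sumr -sumrB; apply: eq_bigr => w _.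
rewrite mem_common_nbrsU1 in_setD1 /centred_edge adj_sym /adj eq_sym.
case: (w \in common_nbrs E s); rewrite ?andbF /= ?mul0r ?mulr0 ?subr0 //.
by case: (w != v); rewrite /= ?mulr1 ?mulr0 ?subr0 ?mul1r.
Qed.

Lemma common_nbrsU1_near s v : (#|s| <= d)%N -> v \notin s ->
  `|#|common_nbrs E (v |: s)|%:R - p * #|common_nbrs E s|%:R| <=
  2 * gamma * q (minn #|s|.+1 d).
Proof.
case: E_concentrated => dev_le _ sd vs; have := dev_le s v sd vs; rewrite nbr_deviationE.
have one_le : 1 <= gamma * q (minn #|s|.+1 d).
  by apply: le_trans gamma_qd_ge1 _; rewrite ler_wpM2l // mean_nbrs_le // geq_minr.
rewrite (cardsD1 v (common_nbrs E s)) natrD mulrDr.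
have : 0 <= p * (v \in common_nbrs E s)%:R <= 1.
  by rewrite mulr_ge0 //=; case: (v \in _); rewrite ?mulr1 ?mulr0.
by move=> /andP[? ?]; rewrite !ler_norml => /andP[? ?]; apply/andP; split; lra.
Qed.

Lemma common_nbrs_near s m : (m <= d)%N -> #|s| = m ->
  `|#|common_nbrs E s|%:R - q m| <= 2 * m%:R * gamma * q m.
Proof.
elim: m s => [s _ /cards0_eq->|m IH s md /cardS_setU1[v [t [vt ct ->]]]].
  by rewrite common_nbrs0 cardsT card_ord /mean_nbrs expr0 mulr1 subrr normr0 mulr0 !mul0r.
have step := @common_nbrsU1_near t v; rewrite ct (minn_idPl md) in step.
have near : `|p * #|common_nbrs E t|%:R - q m.+1| <= 2 * m%:R * gamma * q m.+1.
  by rewrite mean_nbrsS -mulrBr normrM (gtr0_norm p_gt0) mulrCA ler_wpM2l // IH // ltnW.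
apply: le_trans (ler_distD (p * #|common_nbrs E t|%:R) _ _) _.
by apply: le_trans (lerD (step (ltnW md) vt) near) _; rewrite -[m.+1%:R]natr1; lra.
Qed.

Lemma common_nbrs_le_succ s : #|s| = d.+1 -> #|common_nbrs E s|%:R <= delta * q d.
Proof.
move=> /cardS_setU1[v [t [vt ct ->]]].
have := @common_nbrsU1_near t v; rewrite ct (minn_idPr (leqnSn d)) ler_norml.
move=> /(_ (leqnn _) vt)/andP[_ step].
have := common_nbrs_near (leqnn d) ct; rewrite ler_norml => /andP[_ near].
have near_le : 2 * d%:R * gamma * q d <= 1 * q d.
  rewrite ler_wpM2r //; have := gamma_mul_le (leqnSn d); have := mulr_ge0 (ler0n R d) gamma_ge0.
  by move: delta_le1; lra.
have p_le : p * #|common_nbrs E t|%:R <= gamma * (2 * q d) by apply: ler_pM => //; lra.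
have : 4 * 1 * gamma * q d <= delta * q d by rewrite ler_wpM2r // (gamma_mul_le (ltn0Sn d)).
lra.
Qed.

Let restrict s (f : 'I_n -> R) : 'cV[R]_n := \col_i (if i \in common_nbrs E s then f i else 0).

Lemma quadratic_form1_restrict s (f : 'I_n -> R) :
  quadratic_form 1 (restrict s f) = \sum_(u in common_nbrs E s) f u ^+ 2.
Proof.
rewrite quadratic_form1 [RHS]big_mkcond; apply: eq_bigr => i _; rewrite mxE.
by case: ifP; rewrite ?expr0n.
Qed.

Lemma quadratic_form_restrict s (f : 'I_n -> R) :
  quadratic_form (centred_adj_mx p E s) (restrict s f) =
  centred_form (adj E) p (common_nbrs E s) f + p * \sum_(u in common_nbrs E s) f u ^+ 2.
Proof.
set A := common_nbrs E s.
rewrite quadratic_formE centred_formE mulr_sumr -big_split [RHS]big_mkcond.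
apply: eq_bigr => i _ /=; rewrite !mxE -/A; case: (boolP (i \in A)) => iA; last first.
  by rewrite big1 // => j _; rewrite !mxE (negPf iA) !mul0r.
rewrite (bigD1 i) //= [X in _ = X + _](bigD1 i) //= adjxx !mxE /centred_edge eqxx /=.
have -> : \sum_(j | j != i) centred_adj_mx p E s i j * f i * restrict s f j 0 =
    \sum_(j in A | j != i) ((adj E i j)%:R - p) * f i * f j.
  rewrite [RHS]big_mkcondl; apply: eq_bigr => j ji; rewrite !mxE -/A iA.
  by case: (j \in A); rewrite ?mulr0 // !mul1r /centred_edge /adj eq_sym ji.
ring.
Qed.

Lemma centred_form_common_nbrs_le s (f : 'I_n -> R) : (#|s| < d)%N ->
  `|centred_form (adj E) p (common_nbrs E s) f| <=
  delta * q #|s|.+1 * \sum_(u in common_nbrs E s) f u ^+ 2.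
Proof.
case: E_concentrated => _ form_le sd; have := form_le s (restrict s f) sd.
rewrite quadratic_form1_restrict quadratic_form_restrict; set norm_sqr := \sum_(u in _) _.
have norm_ge0 : 0 <= norm_sqr by apply: sumr_ge0 => *; apply: sqr_ge0.
have diag_le : p * norm_sqr <= gamma * q #|s|.+1 * norm_sqr.
  rewrite ler_wpM2r // mean_nbrsS mulrCA ler_peMr //.
  by apply: le_trans gamma_qd_ge1 _; rewrite ler_wpM2l // mean_nbrs_le // ltnW.
have delta_ge : 4 * 1 * gamma * (q #|s|.+1 * norm_sqr) <= delta * (q #|s|.+1 * norm_sqr).
  by apply: ler_wpM2r; [rewrite mulr_ge0|apply: (gamma_mul_le (ltn0Sn d))].
have : 0 <= gamma * q #|s|.+1 * norm_sqr by rewrite mulr_ge0 // mulr_ge0.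
have : 0 <= p * norm_sqr by rewrite mulr_ge0.
by move=> ? ?; rewrite !ler_norml => /andP[? ?]; apply/andP; split; lra.
Qed.

Lemma concentrated_pseudorandom : pseudorandom E p delta d.
Proof.
split=> [s sd||]; [|exact: common_nbrs_le_succ|exact: centred_form_common_nbrs_le].
apply: le_trans (common_nbrs_near sd erefl) _; rewrite ler_wpM2r //.
apply: le_trans (gamma_mul_le (leqW sd)); rewrite ler_wpM2r // ler_wpM2r //; lra.
Qed.
End ConcentratedPseudorandom.

Lemma le_sum_term (R : numDomainType) (I : finType) (P : pred I) (F : I -> R) i :
  (forall j, P j -> 0 <= F j) -> P i -> F i <= \sum_(j | P j) F j.
Proof.
by move=> F_ge0 Pi; rewrite (bigD1 i) //= lerDl sumr_ge0 // => j /andP[/F_ge0].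
Qed.

Section ConcentrationMoments.
Variables (R : realType) (n : nat) (p gamma : R) (d j : nat).
Implicit Types (s : {set 'I_n}) (E : {set {set 'I_n}}).
Hypotheses (n_gt0 : (0 < n)%N) (p_gt0 : 0 < p) (p_le1 : p <= 1) (gamma_gt0 : 0 < gamma).
Hypothesis mean_ge1 : 1 <= mean_nbrs n p d.
Let m := (2 ^ j)%N.
Let q : R := mean_nbrs n p d.
Let Q s : R := mean_nbrs n p (minn #|s|.+1 d).

Let scale s : R := ((gamma * Q s) ^+ (2 * m))^-1.
Let term_bound l : R := tuple_bound R l * ((gamma ^+ (2 * m))^-1 * (q ^+ m)^-1).

Definition nbr_moment E s v : R := scale s * nbr_deviation p E s v ^+ (2 * m).

Definition trace_moment E s : R := scale s * \tr (centred_adj_mx p E s ^+ (2 * m)).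

Definition nbr_moment_sum E : R :=
  \sum_(s : {set 'I_n} | (#|s| <= d)%N) \sum_(v | v \notin s) nbr_moment E s v.

Definition trace_moment_sum E : R := \sum_(s : {set 'I_n} | (#|s| < d)%N) trace_moment E s.

Definition moment_sum_bound l : R := d.+1%:R * n%:R ^+ d.+1 * term_bound l.

Let p_ge0 : 0 <= p. Proof. exact: ltW. Qed.
Let q_le_Q s : q <= Q s. Proof. by rewrite mean_nbrs_le // geq_minr. Qed.
Let Q_ge1 s : 1 <= Q s. Proof. exact: le_trans mean_ge1 (q_le_Q s). Qed.
Let q_gt0 : 0 < q. Proof. exact: lt_le_trans mean_ge1. Qed.
Let Q_gt0 s : 0 < Q s. Proof. exact: lt_le_trans (Q_ge1 s). Qed.
Let gQ_gt0 s : 0 < gamma * Q s. Proof. exact: mulr_gt0. Qed.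
Let mean_le_Q s : mean_nbrs n p #|s|.+1 <= Q s.
Proof. by rewrite mean_nbrs_le // geq_minl. Qed.
Let scale_ge0 s : 0 <= scale s. Proof. by rewrite invr_ge0 exprn_ge0 // ltW. Qed.
Let m_gt0 : (0 < m)%N. Proof. by rewrite expn_gt0. Qed.
Let m2_gt0 : (0 < 2 * m)%N. Proof. by rewrite muln_gt0. Qed.
Let expr_even_ge0 (x : R) : 0 <= x ^+ (2 * m). Proof. by rewrite exprM exprn_ge0 ?sqr_ge0. Qed.

Lemma nbr_moment_ge0 E s v : 0 <= nbr_moment E s v.
Proof. by rewrite mulr_ge0 ?expr_even_ge0. Qed.

Lemma trace_moment_ge0 E s : 0 <= trace_moment E s.
Proof. by rewrite mulr_ge0 // mxtrace_exp_even_ge0 // centred_adj_mx_sym. Qed.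

Lemma nbr_moment_sum_ge0 E : 0 <= nbr_moment_sum E.
Proof. by apply: sumr_ge0 => s _; apply: sumr_ge0 => v _; apply: nbr_moment_ge0. Qed.

Lemma trace_moment_sum_ge0 E : 0 <= trace_moment_sum E.
Proof. by apply: sumr_ge0 => s _; apply: trace_moment_ge0. Qed.

Lemma nbr_deviation_le E s v : nbr_moment_sum E <= 1 -> (#|s| <= d)%N -> v \notin s ->
  `|nbr_deviation p E s v| <= gamma * Q s.
Proof.
move=> sum_le1 sd vs.
have moment_le1 : nbr_moment E s v <= 1.
  apply: le_trans sum_le1; apply: le_trans (le_sum_term (P := fun s => (#|s| <= d)%N) _ sd).
    by apply: (le_sum_term (P := fun v => v \notin s)) => // ? _; apply: nbr_moment_ge0.
  by move=> ? _; apply: sumr_ge0 => ? _; apply: nbr_moment_ge0.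
rewrite -(ler_pXn2r m2_gt0) ?nnegrE ?(ltW (gQ_gt0 s)) // -normrX ger0_norm ?expr_even_ge0 //.
by move: moment_le1; rewrite /nbr_moment ler_pdivrMl ?exprn_gt0 // mulr1.
Qed.

Lemma quadratic_form_centred_le E s (f : 'cV[R]_n) : trace_moment_sum E <= 1 -> (#|s| < d)%N ->
  `|quadratic_form (centred_adj_mx p E s) f| <= gamma * Q s * quadratic_form 1 f.
Proof.
move=> sum_le1 sd.
have moment_le1 : trace_moment E s <= 1.
  apply: le_trans sum_le1; apply: (le_sum_term (P := fun s => (#|s| < d)%N)) => // ? _.
  exact: trace_moment_ge0.
have bound_ge0 := mulr_ge0 (ltW (gQ_gt0 s)) (quadratic_form1_ge0 f).
rewrite -(ler_pXn2r m2_gt0) ?nnegrE // -normrX ger0_norm ?expr_even_ge0 // exprMn.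
have := quadratic_form_exp_le_mxtrace f j (centred_adj_mx_sym p E s); rewrite expnS.
move/le_trans; apply; rewrite ler_wpM2r ?exprn_ge0 ?quadratic_form1_ge0 //.
by move: moment_le1; rewrite /trace_moment ler_pdivrMl ?exprn_gt0 // mulr1.
Qed.

Lemma moment_sum_concentrated E :
  nbr_moment_sum E + trace_moment_sum E <= 1 -> concentrated E p gamma d.
Proof.
have := nbr_moment_sum_ge0 E; have := trace_moment_sum_ge0 E => trace_ge0 nbr_ge0 sum_le1.
split=> [s v sd vs|s f sd]; first by apply: nbr_deviation_le => //; lra.
by rewrite -(minn_idPl sd); apply: quadratic_form_centred_le => //; lra.
Qed.

Lemma scale_mul_le s : scale s * Q s ^+ m <= (gamma ^+ (2 * m))^-1 * (q ^+ m)^-1.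
Proof.
rewrite /scale exprMn invfM -mulrA ler_wpM2l ?invr_ge0 ?exprn_ge0 ?(ltW gamma_gt0) //.
rewrite mul2n -addnn exprD invfM -mulrA mulVf ?expf_neq0 ?gt_eqF // mulr1.
by rewrite lef_pV2 ?posrE ?exprn_gt0 // lerXn2r ?nnegrE ?(ltW q_gt0) ?(ltW (Q_gt0 s)).
Qed.

Lemma expectation_nbr_moment_le s v : v \notin s ->
  expectation p (fun E => nbr_moment E s v) <= term_bound (2 * m).
Proof.
move=> vs; rewrite expectationZ.
have moment_le := expectation_nbr_deviation_le p_ge0 p_le1 m vs (Q_ge1 s) (mean_le_Q s).
apply: le_trans (ler_wpM2l (scale_ge0 s) moment_le) _.
by rewrite mulrCA ler_wpM2l ?tuple_bound_ge0 ?scale_mul_le.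
Qed.

Lemma expectation_trace_moment_le s :
  expectation p (fun E => trace_moment E s) <= n%:R * term_bound (2 * m).+1.
Proof.
rewrite expectationZ.
have moment_le := expectation_mxtrace_le p_ge0 p_le1 n_gt0 m_gt0 (Q_ge1 s) (mean_le_Q s).
apply: le_trans (ler_wpM2l (scale_ge0 s) moment_le) _.
rewrite [leRHS]mulrCA [leLHS]mulrCA ler_wpM2l ?tuple_bound_ge0 //.
by rewrite [leLHS]mulrCA ler_wpM2l ?scale_mul_le.
Qed.

Lemma sum_small_sets_le (P : pred {set 'I_n}) (K : R) :
  (forall s, P s -> (#|s| <= d)%N) -> 0 <= K ->
  \sum_(s | P s) n%:R * K <= d.+1%:R * n%:R ^+ d.+1 * K.
Proof.
move=> P_small K_ge0.
apply: le_trans (_ : \sum_(s : {set 'I_n} | (#|s| <= d)%N) n%:R * K <= _).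
  rewrite big_mkcond [leRHS]big_mkcond; apply: ler_sum => s _.
  by case: ifP => [/P_small ->|_] //; case: ifP => // _; rewrite mulr_ge0.
rewrite exprSr -!mulrA; apply: (sum_set_by_card_le (c := fun=> n%:R * K)) => [u _|u ud].
  by rewrite mulr_ge0.
by rewrite card_ord ler_wpM2r ?mulr_ge0 // -!natrX ler_nat leq_pexp2l.
Qed.

Let term_bound_ge0 l : 0 <= term_bound l.
Proof.
have qm_ge0 : 0 <= (q ^+ m)^-1 by rewrite invr_ge0 exprn_ge0 // ltW.
by rewrite mulr_ge0 ?tuple_bound_ge0 // mulr_ge0 // invr_ge0 exprn_ge0 // ltW.
Qed.

Lemma expectation_nbr_moment_sum_le :
  expectation p nbr_moment_sum <= moment_sum_bound (2 * m).
Proof.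
rewrite expectation_sum; apply: le_trans (sum_small_sets_le (fun s => id) (term_bound_ge0 _)).
apply: ler_sum => s _; rewrite expectation_sum.
apply: le_trans (_ : \sum_(v : 'I_n) term_bound (2 * m) <= _); last first.
  by rewrite sumr_const card_ord mulr_natl.
rewrite big_mkcond; apply: ler_sum => v _.
by case: ifP => // vs; apply: expectation_nbr_moment_le.
Qed.

Lemma expectation_trace_moment_sum_le :
  expectation p trace_moment_sum <= moment_sum_bound (2 * m).+1.
Proof.
rewrite expectation_sum.
apply: le_trans (sum_small_sets_le (fun s => @ltnW _ _) (term_bound_ge0 _)).
by apply: ler_sum => s _; apply: expectation_trace_moment_le.
Qed.

Lemma ER_prob_not_concentrated_le :
  ER_prob p (fun E => ~ concentrated E p gamma d) <=
  moment_sum_bound (2 * m) + moment_sum_bound (2 * m).+1.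
Proof.
apply: le_trans (lerD expectation_nbr_moment_sum_le expectation_trace_moment_sum_le).
rewrite -expectationD; apply: ER_prob_le_expectation => // [E|E not_concentrated].
  by rewrite addr_ge0 ?nbr_moment_sum_ge0 ?trace_moment_sum_ge0.
by rewrite leNgt; apply/negP => /ltW/moment_sum_concentrated.
Qed.
End ConcentrationMoments.

(** * Asymptotics *)

Section Asymptotics.
Variables (R : realType) (alpha : R).
Hypothesis alpha_gt0 : 0 < alpha.

Lemma powR_eventually_ge (x K : R) : 0 < x ->
  exists N : nat, forall n : nat, (N <= n)%N -> K <= n%:R `^ x.
Proof.
move=> x_gt0; pose K1 := Num.max K 1.
have K1_gt0 : 0 < K1 by rewrite lt_max ltr01 orbT.
exists (Num.bound (K1 `^ x^-1)) => n Nn.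
have root_le : K1 `^ x^-1 <= n%:R.
  rewrite -[leLHS]ger0_norm ?powR_ge0 //; apply/ltW/(lt_le_trans (archi_boundP _)).
    exact: normr_ge0.
  by rewrite ler_nat ger0_norm ?powR_ge0.
apply: le_trans (_ : K1 <= _); first by rewrite le_max lexx.
have <- : (K1 `^ x^-1) `^ x = K1 by rewrite -powRrM mulVf ?gt_eqF // powRr1 // ltW.
by apply: ge0_ler_powR; rewrite ?nnegrE ?powR_ge0 ?(ltW x_gt0).
Qed.

Lemma density_le1 n : (0 < n)%N -> n%:R `^ (- alpha) <= 1 :> R.
Proof. by move=> n_gt0; rewrite -[leRHS](powRr0 n%:R) ler_powR ?ler1n // oppr_le0 ltW. Qed.

Lemma mean_nbrs_powR n d : (0 < n)%N ->
  mean_nbrs n (n%:R `^ (- alpha)) d = n%:R `^ (1 - alpha * d%:R) :> R.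
Proof.
move=> n_gt0; have n_neq0 : n%:R != 0 :> R by rewrite pnatr_eq0 -lt0n.
rewrite powRD ?n_neq0 ?implybT // powRr1 // /mean_nbrs -mulNr powRrM powR_mulrn //.
exact: powR_ge0.
Qed.

Lemma eventually_small_density gamma d : 0 < gamma -> alpha * d%:R < 1 ->
  exists N : nat, forall n, (N <= n)%N -> let p := n%:R `^ (- alpha) in
    [/\ 0 < p, p <= gamma & 1 <= gamma * mean_nbrs n p d].
Proof.
move=> gamma_gt0; rewrite -subr_gt0 => eta_gt0.
have [N1 density_large] := powR_eventually_ge gamma^-1 alpha_gt0.
have [N2 mean_large] := powR_eventually_ge gamma^-1 eta_gt0.
exists (maxn 1 (maxn N1 N2)) => n.
rewrite !geq_max => /and3P[n_gt0 /density_large density_ge /mean_large mean_ge] p.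
split; first by rewrite powR_gt0 ?ltr0n.
  by rewrite /p powRN invf_ple ?posrE ?powR_gt0 ?ltr0n.
by rewrite /p mean_nbrs_powR // -ler_pdivrMl // mulr1.
Qed.

Lemma whp_overwhelming_mono (P Q : forall n, {set {set 'I_n}} -> Prop) :
  (exists N : nat, forall n, (N <= n)%N -> forall E, P n E -> Q n E) ->
  whp_overwhelming alpha P -> whp_overwhelming alpha Q.
Proof.
move=> [N PQ] whpP C C_gt0; have [N' probP] := whpP C C_gt0.
exists (maxn 1 (maxn N N')) => n; rewrite !geq_max => /and3P[n_gt0 Nn N'n].
apply: le_trans (probP n N'n); rewrite /ER_prob big_mkcondr [leRHS]big_mkcondr.
apply: ler_sum => E _; have weight_ge0 := ER_weight_ge0 (powR_ge0 _ _) (density_le1 n_gt0) E.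
case: asboolP => [nQ|_]; last by case: ifP.
by case: asboolP => // /contrapT PE; case: nQ; apply: PQ.
Qed.

Lemma moment_sum_bound_powR n gamma d j l : (0 < n)%N ->
  moment_sum_bound n (n%:R `^ (- alpha)) gamma d j l =
  d.+1%:R * (tuple_bound R l * (gamma ^+ (2 * 2 ^ j))^-1) *
  n%:R `^ (d.+1%:R - (1 - alpha * d%:R) * (2 ^ j)%:R).
Proof.
move=> n_gt0; have n_neq0 : n%:R != 0 :> R by rewrite pnatr_eq0 -lt0n.
rewrite /moment_sum_bound mean_nbrs_powR // [in RHS]powRD ?n_neq0 ?implybT // powR_mulrn //.
rewrite [in RHS]powRN [in RHS]powRrM powR_mulrn ?powR_ge0 //; ring.
Qed.

(* For [2 ^ j] large enough the power of [n] in the moment bounds beats [n ^ -(C + 1)],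
   and the remaining factor [n] absorbs the constant. *)
Lemma whp_concentrated gamma d : 0 < gamma -> alpha * d%:R < 1 ->
  whp_overwhelming alpha (fun n E => concentrated E (n%:R `^ (- alpha)) gamma d).
Proof.
move=> gamma_gt0 ad C C_gt0; pose eta := 1 - alpha * d%:R.
have eta_gt0 : 0 < eta by rewrite subr_gt0.
have ratio_ge0 : 0 <= (C + d%:R + 2) / eta by rewrite divr_ge0 ?(ltW eta_gt0) // !addr_ge0 // ltW.
pose j := Num.bound ((C + d%:R + 2) / eta).
have exponent_le : C + d%:R + 2 <= eta * (2 ^ j)%:R.
  rewrite mulrC -ler_pdivrMr // ltW // (lt_le_trans (archi_boundP ratio_ge0)) //.
  by rewrite ler_nat ltnW // ltn_expl.
pose K := d.+1%:R * (tuple_bound R (2 * 2 ^ j) * (gamma ^+ (2 * 2 ^ j))^-1) +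
          d.+1%:R * (tuple_bound R (2 * 2 ^ j).+1 * (gamma ^+ (2 * 2 ^ j))^-1).
have K_ge0 : 0 <= K.
  have scale_ge0 : 0 <= (gamma ^+ (2 * 2 ^ j))^-1 by rewrite invr_ge0 exprn_ge0 // ltW.
  by rewrite addr_ge0 // mulr_ge0 // mulr_ge0 // tuple_bound_ge0.
have [N1 mean_large] := powR_eventually_ge 1 eta_gt0.
have [N2 n_large] := powR_eventually_ge K (@ltr01 R).
exists (maxn 1 (maxn N1 N2)) => n.
rewrite !geq_max => /and3P[n_gt0 /mean_large mean_ge1 /n_large].
rewrite powRr1 // => K_le; have n_pos : 0 < n%:R :> R by rewrite ltr0n.
apply: le_trans (ER_prob_not_concentrated_le j n_gt0 _ _ gamma_gt0 _) _.
- exact: powR_gt0.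
- exact: density_le1.
- by rewrite mean_nbrs_powR.
rewrite !moment_sum_bound_powR // -mulrDl -/K -/eta.
apply: le_trans (_ : n%:R * n%:R `^ (- C - 1) <= _); last first.
  by rewrite -{1}(powRr1 (ltW n_pos)) -powRD ?(gt_eqF n_pos) ?implybT // addrC subrK.
apply: ler_pM; rewrite ?powR_ge0 //.
by rewrite ler_powR ?ler1n // -natr1; move: exponent_le; lra.
Qed.

Lemma whp_pseudorandom delta d : 0 < delta -> delta <= 1 -> alpha * d%:R < 1 ->
  whp_overwhelming alpha (fun n E => pseudorandom E (n%:R `^ (- alpha)) delta d).
Proof.
move=> delta_gt0 delta_le1 ad; pose gamma := delta / (4 * d.+1%:R).
have c_gt0 : 0 < 4 * d.+1%:R :> R by rewrite mulr_gt0.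
have gamma_gt0 : 0 < gamma by rewrite divr_gt0.
apply: whp_overwhelming_mono (whp_concentrated gamma_gt0 ad).
have [N regime] := eventually_small_density gamma_gt0 ad.
exists N => n /regime[p_gt0 p_le mean_ge] E; apply: concentrated_pseudorandom => //.
by rewrite /gamma mulrC divfK ?gt_eqF.
Qed.

Lemma whp_homology_vanishes d k : (0 < d)%N -> alpha < d%:R^-1 -> (2 * d - 1 <= k <= 2 * d)%N ->
  whp_overwhelming alpha (fun n E => homology_vanishes (Zt E) k).
Proof.
move=> d_gt0 ad k_range; have ad_lt1 : alpha * d%:R < 1 by rewrite -ltr_pdivlMr ?ltr0n ?div1r.
pose c : R := 32 * (6 * d%:R + 1) * d.+1%:R; pose delta := c^-1.
have c_ge1 : 1 <= c by rewrite !mulr_ege1 ?ler1n ?lerDr ?mulr_ge0.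
have delta_gt0 : 0 < delta by rewrite invr_gt0 (lt_le_trans ltr01).
have delta_le1 : delta <= 1 by rewrite invf_le1 ?(lt_le_trans ltr01).
apply: whp_overwhelming_mono (whp_pseudorandom delta_gt0 delta_le1 ad_lt1).
have [N regime] := eventually_small_density delta_gt0 ad_lt1.
exists N => n /regime[p_gt0 p_le mean_ge] E; apply: pseudorandom_homology_vanishes => //.
by rewrite mulfV // gt_eqF // (lt_le_trans ltr01).
Qed.
End Asymptotics.

Theorem theorem6p1 (R : realType) (d : nat) (alpha : R) :
  (1 <= d)%N -> 0 < alpha ->
  (alpha < d%:R^-1 ->
     whp_overwhelming alpha (fun n E => homology_vanishes (Zt E) (2 * d))) /\
  (alpha < (d.+1)%:R^-1 ->
     whp_overwhelming alpha (fun n E => homology_vanishes (Zt E) (2 * d - 1))).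
Proof.
move=> d_gt0 alpha_gt0; split=> alpha_lt; apply: (whp_homology_vanishes alpha_gt0 d_gt0).
- exact: alpha_lt.
- by rewrite leq_subr leqnn.
- by apply: lt_trans alpha_lt _; rewrite ltf_pV2 ?posrE ?ltr0n // ltr_nat.
- by rewrite leqnn leq_subr.
Qed.
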